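(* The homotopy type of $\operatorname{Conf}(n, X \times Y)$, for Hausdorff spaces $X$ and $Y$ and $n\in\mathbb{N}$, depends only on the homotopy types of the $\mathcal{G}(n)^{op}$-shaped diagrams $\Gamma' \mapsto \operatorname{Conf}(\Gamma', X)$ and $\Gamma'' \mapsto \operatorname{Conf}(\Gamma'', Y)$. That is: if $X,\tilde X,Y,\tilde Y$ are Hausdorff spaces such that the diagrams $\operatorname{Conf}(-,X)$ and $\operatorname{Conf}(-,\tilde X)$ are weakly equivalent and the diagrams $\operatorname{Conf}(-,Y)$ and $\operatorname{Conf}(-,\tilde Y)$ are weakly equivalent, then $\operatorname{Conf}(n,X\times Y)$ and $\operatorname{Conf}(n,\tilde X\times\tilde Y)$ are weakly equivalent.
   Context: $\mathcal{G}(n)$ is the poset of simple graphs on the vertex set $\{1,\ldots,n\}$, ordered by inclusion of edge sets. For such a graph $\Gamma$ and a space $Z$, $\operatorname{Conf}(\Gamma,Z) = \{(z_1,\ldots,z_n)\in Z^n : i\sim_\Gamma j \implies z_i\neq z_j\}$; an inclusion $\Gamma'\subseteq\Gamma$ induces the inclusion $\operatorname{Conf}(\Gamma,Z)\subseteq\operatorname{Conf}(\Gamma',Z)$, so $\operatorname{Conf}(-,Z)\colon\mathcal{G}(n)^{op}\to\mathrm{Top}$ is a functor. $\operatorname{Conf}(n,Z)$ is the case where $\Gamma$ is the complete graph. Two diagrams (or spaces) are weakly equivalent, i.e. have the same homotopy type, if they are connected by a finite zigzag of natural transformations that are objectwise weak homotopy equivalences. *)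

(* Defs.v *)
From HB Require Import structures.
From mathcomp Require Import all_boot all_order all_algebra.
From mathcomp Require Import boolp classical_sets functions reals topology.
From mathcomp Require Import normedtype.
From Stdlib Require Import Relation_Operators.

Set Implicit Arguments.
Unset Strict Implicit.
Unset Printing Implicit Defensive.

Import Order.TTheory GRing.Theory Num.Theory.
Import numFieldNormedType.Exports.

Local Open Scope classical_set_scope.
Local Open Scope ring_scope.

Section Pi0.
Variables (R : realType) (Z : topologicalType).

Definition path_component (z : Z) : set Z :=
  [set w | exists g : R -> Z,
     [/\ {within `[0, 1], continuous g}, g 0 = z & g 1 = w]].

Definition pi0 : set (set Z) := range path_component.

End Pi0.

Arguments path_component R {Z} z.
Arguments pi0 R Z : clear implicits.

Definition pi0_map (R : realType) (Z W : topologicalType) (f : Z -> W)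
    (c : set Z) : set W :=
  \bigcup_(z in c) path_component R (f z).

Section HomotopyGroups.
Variables (R : realType) (k : nat).

Definition cube : set 'rV[R]_k := [set t | forall i, 0 <= t ord0 i <= 1].

Definition cube_boundary : set 'rV[R]_k :=
  [set t | cube t /\ exists i, t ord0 i = 0 \/ t ord0 i = 1].

(* Maps of pairs (I^k, dI^k) -> (Z, z) and their homotopies are represented by
   total functions of which only the restriction to the cube is constrained;
   two functions that agree on the cube are thus homotopic. *)
Definition spheroid (Z : topologicalType) (z : Z) : set ('rV[R]_k -> Z) :=
  [set a | {within cube, continuous a} /\
           forall t, cube_boundary t -> a t = z].

Definition spheroid_homotopic (Z : topologicalType) (z : Z)
    (a b : 'rV[R]_k -> Z) : Prop :=
  exists H : R * 'rV[R]_k -> Z,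
    [/\ {within `[0, 1] `*` cube, continuous H},
        forall t, cube t -> H (0, t) = a t,
        forall t, cube t -> H (1, t) = b t &
        forall s t, 0 <= s <= 1 -> cube_boundary t -> H (s, t) = z].

Definition spheroid_class (Z : topologicalType) (z : Z)
    (a : 'rV[R]_k -> Z) : set ('rV[R]_k -> Z) :=
  [set b | spheroid z b /\ spheroid_homotopic z a b].

Definition homotopy_group (Z : topologicalType) (z : Z) :
    set (set ('rV[R]_k -> Z)) :=
  [set spheroid_class z a | a in spheroid z].

Definition homotopy_group_map (Z W : topologicalType) (f : Z -> W) (z : Z)
    (c : set ('rV[R]_k -> Z)) : set ('rV[R]_k -> W) :=
  \bigcup_(a in c) spheroid_class (f z) (f \o a).

End HomotopyGroups.

Arguments cube R k : clear implicits.
Arguments cube_boundary R k : clear implicits.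
Arguments spheroid R k {Z} z.
Arguments homotopy_group R k {Z} z.

(* The group law on the homotopy groups is concatenation of spheroids along
   one coordinate, which f preserves on the nose: the map induced by f is a
   group homomorphism, hence an isomorphism as soon as it is bijective. The
   condition on pi0 is not relative to a base point, so that a space weakly
   equivalent to the empty space is empty. *)
Definition weak_homotopy_equivalence (R : realType) (Z W : topologicalType)
    (f : Z -> W) : Prop :=
  [/\ continuous f,
      set_bij (pi0 R Z) (pi0 R W) (pi0_map R f) &
      forall (k : nat) (z : Z), (0 < k)%N ->
        set_bij (homotopy_group R k z) (homotopy_group R k (f z))
                (homotopy_group_map f z)].

Definition weakly_equivalent (R : realType) :
    topologicalType -> topologicalType -> Prop :=
  clos_refl_sym_trans topologicalType (fun Z W =>
    exists f : Z -> W, weak_homotopy_equivalence R f).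

Record op_diagram (d : Order.disp_t) (P : porderType d) := OpDiagram {
  diag_obj :> P -> topologicalType;
  diag_map : forall a b : P, (a <= b)%O ->
    continuousType (diag_obj b) (diag_obj a);
  diag_map_id : forall (a : P) (aa : (a <= a)%O), diag_map aa =1 id;
  diag_map_comp : forall (a b c : P) (ab : (a <= b)%O) (bc : (b <= c)%O)
    (ac : (a <= c)%O), diag_map ab \o diag_map bc =1 diag_map ac
}.

Record nat_trans (d : Order.disp_t) (P : porderType d) (D E : op_diagram P) :=
  NatTrans {
    nt_map :> forall a : P, continuousType (D a) (E a);
    nt_natural : forall (a b : P) (ab : (a <= b)%O),
      nt_map a \o diag_map D ab =1 diag_map E ab \o nt_map b
  }.

Definition diagrams_weakly_equivalent (R : realType) (d : Order.disp_t)
    (P : porderType d) : op_diagram P -> op_diagram P -> Prop :=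
  clos_refl_sym_trans (op_diagram P) (fun D E =>
    exists phi : nat_trans D E,
      forall a : P, weak_homotopy_equivalence R (phi a)).

Record sgraph (n : nat) := SGraph {
  edges : {set {set 'I_n}};
  edges_card2 : [forall e in edges, #|e| == 2]
}.

HB.instance Definition _ (n : nat) := [isSub for @edges n].
HB.instance Definition _ (n : nat) := [Choice of sgraph n by <:].

Section SgraphOrder.
Variable n : nat.
Implicit Types G H K : sgraph n.

Definition le_sgraph G H : bool := edges G \subset edges H.

Lemma le_sgraph_refl : reflexive le_sgraph.
Proof. by move=> G; apply: subxx. Qed.

Lemma le_sgraph_anti : antisymmetric le_sgraph.
Proof.
by move=> G H GH; apply: val_inj; apply/eqP; rewrite finset.eqEsubset.
Qed.

Lemma le_sgraph_trans : transitive le_sgraph.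
Proof. by move=> G H K; apply: fintype.subset_trans. Qed.

HB.instance Definition _ := Order.Le_isPOrder.Build
  Order.SetSubsetOrder.subset_display (sgraph n)
  le_sgraph_refl le_sgraph_anti le_sgraph_trans.

End SgraphOrder.

Lemma le_sgraphE (n : nat) (G H : sgraph n) :
  (G <= H)%O = (edges G \subset edges H).
Proof. by []. Qed.

Definition adjacent (n : nat) (G : sgraph n) : rel 'I_n :=
  fun i j => [set i; j]%SET \in edges G.

Lemma complete_graph_subproof (n : nat) :
  [forall e in [set e : {set 'I_n} | #|e| == 2]%SET, #|e| == 2].
Proof. by apply/forall_inP => e; rewrite inE. Qed.

Definition complete_graph (n : nat) : sgraph n :=
  SGraph (complete_graph_subproof n).

Lemma adjacent_irreflexive (n : nat) (G : sgraph n) : irreflexive (adjacent G).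
Proof.
move=> i; apply/negP => /(forall_inP (edges_card2 G)).
by rewrite finset.setUid cards1.
Qed.

Lemma adjacent_complete (n : nat) (i j : 'I_n) :
  adjacent (complete_graph n) i j = (i != j).
Proof. by rewrite /adjacent inE cards2 eqSS eqb1. Qed.

Definition conf_set (n : nat) (G : sgraph n) (Z : topologicalType) :
    set {ptws 'I_n -> Z} :=
  [set z | forall i j, adjacent G i j -> z i <> z j].

Arguments conf_set [n] G Z.

Definition Conf (n : nat) (G : sgraph n) (Z : topologicalType) :
    topologicalType :=
  set_type (conf_set G Z).

Section ConfDiagram.
Variables (n : nat) (Z : topologicalType).

Lemma conf_incl_subproof (G H : sgraph n) (GH : (G <= H)%O) (z : Conf H Z) :
  val z \in conf_set G Z.
Proof.
apply/mem_set => i j Gij.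
by apply: (set_mem (valP z)) => //; apply: (fintype.subsetP GH).
Qed.

Definition conf_incl_fun (G H : sgraph n) (GH : (G <= H)%O) (z : Conf H Z) :
    Conf G Z :=
  exist _ (val z) (conf_incl_subproof GH z).

Lemma conf_incl_continuous (G H : sgraph n) (GH : (G <= H)%O) :
  continuous (conf_incl_fun GH).
Proof.
by apply: continuous_comp_initial => z; exact: initial_continuous.
Qed.

Definition conf_incl (G H : sgraph n) (GH : (G <= H)%O) :
    continuousType (Conf H Z) (Conf G Z) :=
  mkcts (@conf_incl_continuous G H GH).

Lemma conf_incl_id (G : sgraph n) (GG : (G <= G)%O) : conf_incl GG =1 id.
Proof. by move=> z; apply: val_inj. Qed.

Lemma conf_incl_comp (G H K : sgraph n) (GH : (G <= H)%O) (HK : (H <= K)%O)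
    (GK : (G <= K)%O) : conf_incl GH \o conf_incl HK =1 conf_incl GK.
Proof. by move=> z; apply: val_inj. Qed.

Definition conf_diagram : op_diagram (sgraph n) :=
  OpDiagram conf_incl_id conf_incl_comp.

End ConfDiagram.

(* Main.v *)
(** Since X and Y are Hausdorff, Conf(n, X x Y) is covered by the open subsets
    Conf(G, X) x Conf(G', Y), where G and G' range over the pairs of graphs
    whose union is complete. The intersection of two of them is the one given
    by the unions of the graphs, so the cover is closed under intersection and
    Conf(n, X x Y) is the homotopy colimit of the diagram of its members; it
    remains to see that this homotopy colimit preserves objectwise weak
    equivalences.

    The homotopy colimit of a diagram F over P^op is modelled by the disjoint
    union of the F p in which a set is open if its trace on each F p is open
    and if it contains every y in F q whose image in some F p with p <= q it
    contains. This non-Hausdorff space is covered by the open sets of the points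
    of index >= p, which deformation retract onto F p.

    Weak equivalences are characterized by a relative lifting property up to
    homotopy for the pairs (ball, sphere). This property is local with respect
    to an open cover closed under intersection: subdivide the cube so that each
    small cube is mapped into a member of the cover, then lift cell by cell,
    using for each cell the intersection of the sets attached to the small
    cubes containing it. *)

Require Import Defs.
From HB Require Import structures.
From mathcomp Require Import all_boot all_order all_algebra.
From mathcomp Require Import boolp classical_sets functions reals topology.
From mathcomp Require Import normedtype interval_inference prodnormedzmodule.
From mathcomp Require Import zify lra ring.
From Stdlib Require Import Relation_Operators.

Set Implicit Arguments.
Unset Strict Implicit.
Unset Printing Implicit Defensive.

Import Order.TTheory GRing.Theory Num.Theory.
Import numFieldNormedType.Exports.

Local Open Scope classical_set_scope.
Local Open Scope ring_scope.

(** * Continuity on subsets and lifting properties *)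

(** A lifting square commutes strictly on the sphere, but once some cells are lifted, the next cell
    receives boundary values that lie over [a] only up to a homotopy. Hence the two forms
    [rel_lifting] and [homotopy_lifting]; for balls, a collar absorbs the boundary homotopy, so that
    the first form implies the second. The open set [O] is part of both forms because the homotopy
    over a cell has to stay where the cells attached to it later can still use it. Weak equivalences
    are defined by spheroids, which are constant on the boundary, whereas a lifting problem allows
    any map on the sphere. The gap is bridged by a deformation of the sphere that collapses
    everything except one face. A continuous map into the model of the homotopy colimit may jump,
    but near each point only to larger indices. Values of smaller index are therefore placed on
    closed sets: the closed ball of radius 1/2 carries the new values, the ring around it is left
    for the transition to the given values on the sphere, and [push] with constant 1/2 spreads the
    inner ball over the whole ball. *)

Lemma within_continuousP (T S : topologicalType) (A : set T) (f : T -> S) :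
  {within A, continuous f} <->
  forall x, A x -> forall V, nbhs (f x) V -> \forall y \near x, A y -> V (f y).
Proof.
split=> [/subspace_continuousP cf x Ax V fxV|cf].
  by have := cf x Ax V fxV; rewrite /= nbhs_simpl /within /=.
by apply/subspace_continuousP => x Ax V fxV; exact: cf.
Qed.

Lemma within_comp (T S U : topologicalType) (A : set T) (B : set S)
    (f : T -> S) (g : S -> U) :
  {within B, continuous g} -> {within A, continuous f} ->
  (forall x, A x -> B (f x)) -> {within A, continuous (g \o f)}.
Proof.
move=> /within_continuousP cg /within_continuousP cf AB.
apply/within_continuousP => x Ax V gV.
have := cf x Ax _ (cg _ (AB _ Ax) V gV).
by apply: filterS => y h Ay; apply: h => //; exact: AB.
Qed.

Lemma within_compl (T S U : topologicalType) (A : set T)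
    (f : T -> S) (g : S -> U) :
  continuous g -> {within A, continuous f} -> {within A, continuous (g \o f)}.
Proof.
move=> cg cf; apply: (@within_comp _ _ _ A setT) => //.
exact: continuous_subspaceT.
Qed.

Lemma within_pair (T S U : topologicalType) (A : set T)
    (f : T -> S) (g : T -> U) :
  {within A, continuous f} -> {within A, continuous g} ->
  {within A, continuous (fun x => (f x, g x))}.
Proof.
move=> /within_continuousP cf /within_continuousP cg.
apply/within_continuousP => x Ax V [[V1 V2] /= [fV1 gV2] V12].
apply: filterS (filterI (cf x Ax _ fV1) (cg x Ax _ gV2)) => y [h1 h2] Ay.
by apply: V12; split; [exact: h1|exact: h2].
Qed.

Lemma within_eq (T S : topologicalType) (A : set T) (f g : T -> S) :
  (forall x, A x -> f x = g x) ->
  {within A, continuous f} -> {within A, continuous g}.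
Proof.
move=> fg; apply: (@subspace_eq_continuous _ A _ f g).
by move=> x; rewrite inE => /fg.
Qed.

Lemma within_paste (T S : topologicalType) (A M N : set T) (f g k : T -> S) :
  closed M -> closed N -> (forall x, A x -> M x \/ N x) ->
  (forall x, A x -> M x -> k x = f x) -> (forall x, A x -> N x -> k x = g x) ->
  {within A `&` M, continuous f} -> {within A `&` N, continuous g} ->
  {within A, continuous k}.
Proof.
move=> cM cN AMN kf kg.
move=> /(within_eq (g := k)) cf /(within_eq (g := k)) cg.
have {}cf : {within A `&` M, continuous k} by apply: cf => x [Ax Mx];
  rewrite kf.
have {}cg : {within A `&` N, continuous k} by apply: cg => x [Ax Nx];
  rewrite kg.
(* When [x] is not in the closed set [L], the condition on [L] is vacuous near [x]; so each piece
   controls its own points, wherever [x] lies. *)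
have aux (L : set T) x V : closed L -> {within A `&` L, continuous k} -> A x ->
    nbhs (k x) V -> \forall y \near x, A y -> L y -> V (k y).
  move=> cL /within_continuousP ck Ax kV.
  have [Lx|Lx] := pselect (L x).
    by have := ck x (conj Ax Lx) V kV; apply: filterS => y h Ay Ly; apply: h.
  have : nbhs x (~` L) by apply: open_nbhs_nbhs; split=> //;
    exact: closed_openC.
  by apply: filterS.
apply/within_continuousP => x Ax V kV.
have hM := aux M x V cM cf Ax kV; have hN := aux N x V cN cg Ax kV.
near=> y => Ay; have [My|Ny] := AMN _ Ay.
  by move: Ay My; near: y.
by move: Ay Ny; near: y.
Unshelve. all: by end_near.
Qed.

Section ContinuityCalculus.
Context {R : realType} {T : topologicalType}.

Lemma cont_pair (S U : topologicalType) (f : T -> S) (g : T -> U) :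
  continuous f -> continuous g -> continuous (fun x => (f x, g x)).
Proof. by move=> cf cg x; exact: (cvg_pair (cf x) (cg x)). Qed.

Lemma cont_comp (S U : topologicalType) (f : T -> S) (g : S -> U) :
  continuous g -> continuous f -> continuous (fun x => g (f x)).
Proof. by move=> cg cf x; apply: continuous_comp; [exact: cf|exact: cg]. Qed.

Lemma cont_fst (S U : topologicalType) (f : T -> S * U) :
  continuous f -> continuous (fun x => (f x).1).
Proof. by move=> cf; apply: (cont_comp (g := fst)) => // x; exact: cvg_fst. Qed.

Lemma cont_snd (S U : topologicalType) (f : T -> S * U) :
  continuous f -> continuous (fun x => (f x).2).
Proof. by move=> cf; apply: (cont_comp (g := snd)) => // x; exact: cvg_snd. Qed.

Lemma cont_cst (S : topologicalType) (c : S) : continuous (fun _ : T => c).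
Proof. by move=> x; exact: cvg_cst. Qed.

Lemma cont_id : continuous (fun x : T => x).
Proof. by move=> x; exact: cvg_id. Qed.

Lemma cont_add (V : normedModType R) (f g : T -> V) :
  continuous f -> continuous g -> continuous (fun x => f x + g x).
Proof. by move=> cf cg x; exact: cvgD (cf x) (cg x). Qed.

Lemma cont_opp (V : normedModType R) (f : T -> V) :
  continuous f -> continuous (fun x => - f x).
Proof. by move=> cf x; exact: cvgN (cf x). Qed.

Lemma cont_addR (f g : T -> R) :
  continuous f -> continuous g -> continuous (fun x => f x + g x).
Proof. by move=> cf cg x; exact: (@cvgD _ R^o) (cf x) (cg x). Qed.

Lemma cont_oppR (f : T -> R) : continuous f -> continuous (fun x => - f x).
Proof. by move=> cf x; exact: (@cvgN _ R^o) (cf x). Qed.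

Lemma cont_scale (V : normedModType R) (f : T -> R) (g : T -> V) :
  continuous f -> continuous g -> continuous (fun x => f x *: g x).
Proof. by move=> cf cg x; exact: cvgZ (cf x) (cg x). Qed.

Lemma cont_mul (f g : T -> R) :
  continuous f -> continuous g -> continuous (fun x => f x * g x).
Proof. by move=> cf cg x; exact: cvgM (cf x) (cg x). Qed.

Lemma cont_inv (f : T -> R) :
  (forall x, f x != 0) -> continuous f -> continuous (fun x => (f x)^-1).
Proof. by move=> f0 cf x; exact: cvgV (f0 x) (cf x). Qed.

Lemma cont_norm (V : normedModType R) (f : T -> V) :
  continuous f -> continuous (fun x => `|f x|).
Proof. by move=> cf x; exact: cvg_norm (cf x). Qed.

Lemma cont_max (f g : T -> R) :
  continuous f -> continuous g -> continuous (fun x => Num.max (f x) (g x)).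
Proof. exact: max_fun_continuous. Qed.

Lemma cont_min (f g : T -> R) :
  continuous f -> continuous g -> continuous (fun x => Num.min (f x) (g x)).
Proof. exact: min_fun_continuous. Qed.

End ContinuityCalculus.

(** Structural continuity. What remains open is the nonvanishing of denominators and the continuity
    of subterms of no listed shape. *)
Ltac cont := lazymatch goal with
  | |- continuous (fun _ => ?c) => exact: cont_cst
  | |- continuous (fun x => x) => exact: cont_id
  | |- continuous Num.Def.normr => exact: (cont_norm cont_id)
  | |- continuous -%R => exact: (cont_oppR cont_id)
  | |- continuous fst => exact: (cont_fst cont_id)
  | |- continuous snd => exact: (cont_snd cont_id)
  | |- continuous (fun x => (@?f x, @?g x)) => refine (cont_pair _ _); cont
  | |- continuous (fun x => (@?f x).1) => refine (@cont_fst _ _ _ f _); cont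
  | |- continuous (fun x => (@?f x).2) => refine (@cont_snd _ _ _ f _); cont
  | |- continuous (fun x => (@?f x + @?g x)%R) =>
      first [refine (cont_addR _ _) | refine (cont_add _ _)]; cont
  | |- continuous (fun x => (- @?f x)%R) =>
      first [refine (cont_oppR _) | refine (cont_opp _)]; cont
  | |- continuous (fun x => (@?f x * @?g x)%R) => refine (cont_mul _ _); cont
  | |- continuous (fun x => (@?f x *: @?g x)%R) => refine (cont_scale _ _); cont
  | |- continuous (fun x => Num.max (@?f x) (@?g x)) =>
      refine (cont_max _ _); cont
  | |- continuous (fun x => Num.min (@?f x) (@?g x)) =>
      refine (cont_min _ _); cont
  | |- continuous (fun x => `|@?f x|%R) => refine (cont_norm _); cont
  | |- continuous (fun x => ((@?f x)^-1)%R) => refine (cont_inv _ _); [|cont]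
  | |- _ => idtac
  end.

Ltac olra := lazymatch goal with
  | |- is_true (_ <= _) => lra
  | |- is_true (_ < _) => lra
  | |- is_true (_ && _) => lra
  | |- _ => idtac
  end.

Section Lifting.
Context {R : realType}.

Lemma closed_leP (T : topologicalType) (f g : T -> R) :
  continuous f -> continuous g -> closed [set x | f x <= g x].
Proof.
move=> cf cg.
have -> : [set x | f x <= g x] = (fun x => g x - f x) @^-1` [set y | 0 <= y].
  by apply/seteqP; split => x /=; rewrite subr_ge0.
apply: closed_comp; last exact: closed_ge.
by move=> x _; apply: (@cvgB _ R^o); [exact: cg|exact: cf].
Qed.

Lemma within_paste_le (T S : topologicalType) (A : set T) (u : T -> R) (c : R)
    (f g k : T -> S) : continuous u ->
  (forall x, A x -> u x <= c -> k x = f x) ->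
  (forall x, A x -> c <= u x -> k x = g x) ->
  {within A `&` [set x | u x <= c], continuous f} ->
  {within A `&` [set x | c <= u x], continuous g} ->
  {within A, continuous k}.
Proof.
move=> cu kf kg; apply: within_paste => //.
- by apply: closed_leP => //; cont.
- by apply: closed_leP => //; cont.
- by move=> x _ /=; exact/orP/le_total.
Qed.

Section LiftDefs.
Variables (Z W T : topologicalType) (f : Z -> W) (O : set W) (A B : set T).

Definition homotopy_in (D : set T) (H : R * T -> W) (g0 g1 : T -> W) : Prop :=
  [/\ {within `[0, 1] `*` D, continuous H},
      forall t, D t -> H (0, t) = g0 t,
      forall t, D t -> H (1, t) = g1 t &
      forall (s : R) t, 0 <= s <= 1 -> D t -> O (H (s, t))].

(** For a ball and its sphere this is the compression criterion for the mapping cylinder of [f],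
    stated without the cylinder: [b] extends to a lift of [a] up to a homotopy that is stationary on
    [B] and stays in [O]. *)
Definition lifts_rel (a : T -> W) (b : T -> Z) : Prop :=
  exists b' H,
    [/\ {within A, continuous b'}, forall t, B t -> b' t = b t,
        homotopy_in A H (f \o b') a &
        forall (s : R) t, 0 <= s <= 1 -> B t -> H (s, t) = a t].

Definition rel_lifting : Prop :=
  forall (a : T -> W) (b : T -> Z),
    {within A, continuous a} -> {within B, continuous b} ->
    (forall t, A t -> O (a t)) -> (forall t, B t -> f (b t) = a t) ->
  lifts_rel a b.

(** Here the square commutes on [B] only up to [h], and the homotopy obtained extends [h]. This is
    the form in which a cell is attached to cells already lifted. *)
Definition lifts_homotopy (a : T -> W) (b : T -> Z) (h : R * T -> W) : Prop :=
  exists b' H,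
    [/\ {within A, continuous b'}, forall t, B t -> b' t = b t,
        homotopy_in A H (f \o b') a &
        forall (s : R) t, 0 <= s <= 1 -> B t -> H (s, t) = h (s, t)].

Definition homotopy_lifting : Prop :=
  forall (a : T -> W) (b : T -> Z) (h : R * T -> W),
    {within A, continuous a} -> {within B, continuous b} ->
    (forall t, A t -> O (a t)) -> homotopy_in B h (f \o b) a ->
  lifts_homotopy a b h.

End LiftDefs.

(** A retract of a pair inherits its lifts: solve the problem composed with [q], then restrict along
    [p]. This is the passage between balls, cubes and prisms. *)
Lemma lifts_rel_retract (Z W T S : topologicalType) (f : Z -> W) (O : set W)
    (A B : set T) (A' B' : set S) (p : T -> S) (q : S -> T) a b :
  continuous p ->
  (forall t, A t -> A' (p t)) -> (forall t, B t -> B' (p t)) ->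
  (forall t, A t -> q (p t) = t) -> B `<=` A ->
  lifts_rel f O A' B' (a \o q) (b \o q) -> lifts_rel f O A B a b.
Proof.
move=> cp pA pB qp BA [b' [H [cb' bb' [cH H0 H1 HO] HB]]].
exists (b' \o p), (fun x => H (x.1, p x.2)); split => //.
- by apply: (within_comp cb') => //; exact: continuous_subspaceT.
- by move=> t Bt /=; rewrite bb' /= ?qp //; [exact: BA|exact: pB].
- split => /=.
  + apply: (within_comp (f := fun x => (x.1, p x.2)) cH).
      apply: continuous_subspaceT; cont.
      by apply: (cont_comp cp); cont.
    by move=> [s t] [? /pA].
  + by move=> t At; rewrite H0 //; exact: pA.
  + by move=> t At; rewrite H1 /= ?qp //; exact: pA.
  + by move=> s t s01 At; apply: HO => //; exact: pA.
- by move=> s t s01 Bt; rewrite HB /= ?qp //; [exact: BA|exact: pB].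
Qed.

Lemma rel_lifting_retract (Z W T S : topologicalType) (f : Z -> W) (O : set W)
    (A B : set T) (A' B' : set S) (p : T -> S) (q : S -> T) :
  continuous p -> continuous q ->
  (forall t, A t -> A' (p t)) -> (forall t, B t -> B' (p t)) ->
  (forall t, A' t -> A (q t)) -> (forall t, B' t -> B (q t)) ->
  (forall t, A t -> q (p t) = t) -> B `<=` A ->
  rel_lifting f O A' B' -> rel_lifting f O A B.
Proof.
move=> cp cq pA pB qA qB qp BA L a b ca cb aO fb.
apply: (lifts_rel_retract cp pA pB qp BA); apply: L.
- by apply: (within_comp ca) => //; exact: continuous_subspaceT.
- by apply: (within_comp cb) => //; exact: continuous_subspaceT.
- by move=> t /qA /aO.
- by move=> t /qB /fb.
Qed.

Lemma homotopy_lifting_retract (Z W T S : topologicalType) (f : Z -> W)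
    (O : set W) (A B : set T) (A' B' : set S) (p : T -> S) (q : S -> T) :
  continuous p -> continuous q ->
  (forall t, A t -> A' (p t)) -> (forall t, B t -> B' (p t)) ->
  (forall t, A' t -> A (q t)) -> (forall t, B' t -> B (q t)) ->
  (forall t, A t -> q (p t) = t) -> B `<=` A ->
  homotopy_lifting f O A' B' -> homotopy_lifting f O A B.
Proof.
move=> cp cq pA pB qA qB qp BA L a b h ca cb aO [ch h0 h1 hO].
have cprod (U V : topologicalType) (g : U -> V) : continuous g ->
    continuous (fun x : R * U => (x.1, g x.2)).
  by move=> cg; cont; apply: (cont_comp cg); cont.
have [|||| b' [H [cb' bb' [cH H0 H1 HO] HB]]] :=
  L (a \o q) (b \o q) (fun x => h (x.1, q x.2)).
- by apply: (within_comp ca) => //; exact: continuous_subspaceT.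
- by apply: (within_comp cb) => //; exact: continuous_subspaceT.
- by move=> t /qA /aO.
- split=> /=.
  + apply: (within_comp (f := fun x => (x.1, q x.2)) ch).
      by apply: continuous_subspaceT; exact: cprod.
    by move=> [s t] [? /qB].
  + by move=> t /qB /h0.
  + by move=> t /qB /h1.
  + by move=> s t s01 /qB; exact: hO.
exists (b' \o p), (fun x => H (x.1, p x.2)); split => //.
- by apply: (within_comp cb') => //; exact: continuous_subspaceT.
- by move=> t Bt /=; rewrite bb' /= ?qp //; [exact: BA|exact: pB].
- split => /=.
  + apply: (within_comp (f := fun x => (x.1, p x.2)) cH).
      by apply: continuous_subspaceT; exact: cprod.
    by move=> [s t] [? /pA].
  + by move=> t At; rewrite H0 //; exact: pA.
  + by move=> t At; rewrite H1 /= ?qp //; exact: pA.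
  + by move=> s t s01 At; apply: HO => //; exact: pA.
- by move=> s t s01 Bt; rewrite HB /= ?qp //; [exact: BA|exact: pB].
Qed.

End Lifting.

Arguments lifts_rel R {Z W T} f O A B a b.
Arguments lifts_homotopy R {Z W T} f O A B a b h.
Arguments rel_lifting R {Z W T} f O A B.
Arguments homotopy_lifting R {Z W T} f O A B.

(** * Radial deformations of the ball *)

Section Radial.
Context {R : realType} {V : normedModType R}.
Implicit Types (t v : V) (c r s : R).

Definition unit_ball : set V := [set t | `|t| <= 1].
Definition unit_sphere : set V := [set t | `|t| = 1].

Lemma unit_sphere_ball : unit_sphere `<=` unit_ball.
Proof. by rewrite /unit_sphere/unit_ball => t /= ->. Qed.

Lemma closed_norm_le c : closed [set t : V | `|t| <= c].
Proof. by apply: closed_leP; cont. Qed.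

Lemma closed_norm_ge c : closed [set t : V | c <= `|t|].
Proof. by apply: closed_leP; cont. Qed.

(** The ball of radius [c] is stretched onto the unit ball and the rest is projected radially to the
    unit sphere; the maximum keeps the formula continuous at the origin. *)
Definition push c t : V := (Num.max `|t| c)^-1 *: t.

Lemma maxc_gt0 c t : 0 < c -> 0 < Num.max `|t| c.
Proof. by move=> c0; rewrite lt_max c0 orbT. Qed.

Lemma continuous_push c : 0 < c -> continuous (push c).
Proof. by move=> c0; rewrite /push; cont => x; rewrite gt_eqF // maxc_gt0. Qed.

Lemma push_ge c t : c <= `|t| -> push c t = `|t|^-1 *: t.
Proof. by move=> ct; rewrite /push max_l. Qed.

Lemma push_le c t : `|t| <= c -> push c t = c^-1 *: t.
Proof. by move=> ct; rewrite /push max_r. Qed.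

Lemma push_sphere c t : c <= 1 -> unit_sphere t -> push c t = t.
Proof.
by rewrite /unit_sphere/= => c1 t1; rewrite push_ge t1 ?invr1 ?scale1r.
Qed.

Lemma norm_push_ge c t : 0 < c -> c <= `|t| -> unit_sphere (push c t).
Proof.
move=> c0 ct; have t0 : 0 < `|t| by exact: lt_le_trans ct.
by rewrite /unit_sphere/= push_ge // normrZ normfV normr_id mulVf ?gt_eqF.
Qed.

Lemma push_ball c t : 0 < c -> unit_ball (push c t).
Proof.
move=> c0; have m0 := maxc_gt0 t c0.
rewrite /unit_ball/= normrZ normfV (gtr0_norm m0) mulrC ler_pdivrMr // mul1r.
by rewrite le_max lexx.
Qed.

Lemma push_scale c c' r t : 0 < r -> 0 < c -> 0 < c' -> c <= `|t| ->
  c' <= `|r *: t| -> push c' (r *: t) = push c t.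
Proof.
move=> r0 c0 c'0 ct ct'; rewrite !push_ge //.
have t0 : `|t| != 0 by rewrite gt_eqF //; exact: lt_le_trans ct.
rewrite normrZ (gtr0_norm r0) scalerA; congr (_ *: _).
by field; rewrite t0 gt_eqF.
Qed.

(** The time [2 - r] at radius [r] matches [a] at radius 1, where [h] has time 1, and reaches the
    start of [h] at radius 2. *)
Definition collar (W : Type) (a : V -> W) (h : R * V -> W) t : W :=
  if `|t| <= 1 then a t else h (2 - `|t|, push 1 t).

Lemma collar_ball W (a : V -> W) h t : `|t| <= 1 -> collar a h t = a t.
Proof. by rewrite /collar => ->. Qed.

Lemma collar_ge W (a : V -> W) h t :
  (forall x, unit_sphere x -> h (1, x) = a x) -> 1 <= `|t| ->
  collar a h t = h (2 - `|t|, push 1 t).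
Proof.
move=> ha t1; rewrite /collar; case: ifPn => // t1'.
have tE : `|t| = 1 by apply/eqP; rewrite eq_le t1 t1'.
by rewrite push_sphere // tE -(ha t) //; congr (h (_, _)); lra.
Qed.

Lemma continuous_collar (W : topologicalType) (a : V -> W) (h : R * V -> W) :
  {within unit_ball, continuous a} ->
  {within `[0, 1] `*` unit_sphere, continuous h} ->
  (forall x, unit_sphere x -> h (1, x) = a x) ->
  {within [set t | `|t| <= 2], continuous (collar a h)}.
Proof.
move=> ca ch ha.
apply: (within_paste_le (u := fun t : V => `|t|) (c := 1)
   (f := a) (g := fun t => h (2 - `|t|, push 1 t))); first by cont.
- by move=> t _; exact: collar_ball.
- by move=> t _; exact: collar_ge.
- by apply: continuous_subspaceW ca => t [].
- apply: (within_comp (f := fun t => (2 - `|t|, push 1 t)) ch).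
    by apply: continuous_subspaceT; cont; apply: continuous_push.
  move=> t [/= t2 t1]; split; last exact: norm_push_ge.
  by rewrite /= in_itv /=; lra.
Qed.

Lemma collar_in (W : Type) (O : set W) (a : V -> W) (h : R * V -> W) t :
  (forall x, unit_ball x -> O (a x)) ->
  (forall s x, 0 <= s <= 1 -> unit_sphere x -> O (h (s, x))) ->
  `|t| <= 2 -> O (collar a h t).
Proof.
move=> aO hO t2; rewrite /collar; case: ifPn => [/aO//|].
rewrite -ltNge => t1; apply: hO; first by lra.
by apply: norm_push_ge => //; exact: ltW.
Qed.

End Radial.

Arguments unit_ball {R} V.
Arguments unit_sphere {R} V.

(** * Lifting problems on the ball under a homotopy of the boundary data *)

Section RadialLifting.
Context {R : realType} {V : normedModType R}.
Context {Z W : topologicalType} (f : Z -> W) (O : set W).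

(** Chosen so that [rate t *: t] is the point of the collared ball reached at time 1/2: it is
    [4 *: t] up to radius 1/2, by doubling twice, and beyond it has norm 5/2 minus the norm of [t],
    which is the radius at which the collar shows [h] at time [2^-1 * (2 * r - 1)] for [r] the norm
    of [t]. *)
Let rate (t : V) : R := Num.min 4 ((5/2 - `|t|) / Num.max `|t| 2^-1).

Let rate_le t : `|t| <= 2^-1 -> rate t = 4.
Proof.
move=> tl; rewrite /rate max_r // min_l //; lra.
Qed.

Let rate_ge t : 2^-1 <= `|t| -> rate t = (5/2 - `|t|) / `|t|.
Proof.
move=> tl; rewrite /rate max_l // min_r // ler_pdivrMr; lra.
Qed.

Let rate_norm t : unit_ball V t -> 0 <= rate t /\ rate t * `|t| <= 2.
Proof.
rewrite /unit_ball /= => t1; have [tl|/ltW tl] := leP `|t| 2^-1.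
  by rewrite rate_le //; split; lra.
have t0 : 0 < `|t| by lra.
rewrite rate_ge //; split; first by apply: divr_ge0; lra.
by rewrite divfK ?gt_eqF //; lra.
Qed.

(* For [s <= 1/2] the given homotopy runs on the ball of radius 1/2; for
   [s >= 1/2] the ball is mapped to the ball with a collar, on which the
   homotopy [h] of the boundary values is laid out. *)
Lemma homotopy_lifting_of_rel (b : V -> Z) :
  {within unit_sphere V, continuous b} ->
  (forall a, {within unit_ball V, continuous a} ->
     (forall t, unit_ball V t -> O (a t)) ->
     (forall t, unit_sphere V t -> f (b t) = a t) ->
     lifts_rel R f O (unit_ball V) (unit_sphere V) a b) ->
  forall a h, {within unit_ball V, continuous a} ->
     (forall t, unit_ball V t -> O (a t)) ->
     homotopy_in O (unit_sphere V) h (f \o b) a ->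
     lifts_homotopy R f O (unit_ball V) (unit_sphere V) a b h.
Proof.
move=> cb sol a h ca aO [ch h0 h1 hO].
pose A := collar a h.
have cA : {within [set t | `|t| <= 2], continuous A}.
  exact: continuous_collar.
have AO t : `|t| <= 2 -> O (A t) by exact: collar_in.
have norm2 (t : V) : `|2 *: t| = 2 * `|t| by rewrite normrZ ger0_norm.
have Ah t : 1 <= `|t| -> A t = h (2 - `|t|, push 1 t) by exact: collar_ge.
(* After doubling, the unit sphere is the outer rim of the collar, where [A] is [h] at time 0, that
   is [f \o b]: the square now commutes strictly. *)
have [||| b1 [K [cb1 b1b [cK K0 K1 KO] KB]]] := sol (fun t => A (2 *: t)).
- apply: (within_comp (f := fun t => 2 *: t) cA).
    by apply: continuous_subspaceT; cont.
  by move=> t /=; rewrite /unit_ball/= norm2; lra.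
- by move=> t /=; rewrite /unit_ball/= => t1; apply: AO; rewrite norm2; lra.
- move=> t t1; rewrite Ah norm2 t1 ?mulr1; last by lra.
  rewrite (push_scale (c := 1)) ?norm2 ?t1 ?push_sphere //; olra.
  by rewrite subrr h0.
pose p t : V := push 2^-1 t.
(* The scaling factor runs linearly from [rate t] at time 1/2 to 1 at time 1. On the sphere [rate t]
   is 3/2, so the factor is [2 - s], whose collar time is exactly [s]. *)
pose arg (x : R * V) := ((2 - 2 * x.1) * rate x.2 + (2 * x.1 - 1)) *: x.2.
pose H (x : R * V) :=
  if x.1 <= 2^-1 then
    if `|x.2| <= 2^-1 then K (2 * x.1, 2 *: x.2)
    else h (x.1 * (2 * `|x.2| - 1), p x.2)
  else A (arg x).
have cp : continuous p by apply: continuous_push; lra.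
have p_le t : `|t| <= 2^-1 -> p t = 2 *: t.
  by move=> tl; rewrite /p push_le ?invrK.
have p_ge t : 2^-1 <= `|t| -> unit_sphere V (p t).
  by move=> tl; apply: norm_push_ge => //; lra.
have carg : continuous arg.
  by rewrite /arg /rate; cont => x; rewrite gt_eqF // maxc_gt0.
have arg2 s t : 2^-1 <= s <= 1 -> unit_ball V t -> `|arg (s, t)| <= 2.
  move=> s01 t1; have [r0 r2] := rate_norm t1; rewrite /unit_ball /= in t1.
  rewrite normrZ ger0_norm /=; last first.
    by apply: addr_ge0; [apply: mulr_ge0|]; lra.
  by rewrite mulrDl -mulrA; nra.
have argA s t : 2^-1 = s -> unit_ball V t -> H (s, t) = A (arg (s, t)).
  move=> <- t1; rewrite /H /= lexx /arg /=.
  have -> : (2 - 2 * 2^-1) * rate t + (2 * 2^-1 - 1) = rate t by lra.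
  rewrite /unit_ball/= in t1.
  have h2 : 2 / 2 = 1 :> R by lra.
  case: ifPn => [tl|].
    rewrite h2 K1; last by rewrite /unit_ball/= norm2; lra.
    by rewrite scalerA rate_le //; congr (A (_ *: _)); lra.
  rewrite -ltNge => /ltW tl; have t0 : 0 < `|t| by lra.
  have rt : `|rate t *: t| = 5/2 - `|t|.
    rewrite normrZ rate_ge // ger0_norm; last by apply: divr_ge0; lra.
    by rewrite divfK ?gt_eqF.
  have r0 : 0 < rate t by rewrite rate_ge //; apply: divr_gt0; lra.
  rewrite Ah rt; last lra.
  rewrite (push_scale (c := 2^-1)) ?rt //; olra.
  by congr (h (_, _)); lra.
exists (b1 \o p), H; split.
- apply: (within_comp cb1); first exact: continuous_subspaceT.
  by move=> t _; apply: push_ball; lra.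
- by move=> t t1 /=; rewrite /p push_sphere ?b1b //; lra.
- split.
  + apply: (within_paste_le (u := fun x : R * V => x.1) (c := 2^-1)
      (f := H) (g := fun x : R * V => A (arg x))) => //; first by cont.
    * move=> [s t] [_ t1] /= sl; have [/eqP se|sn] := boolP (s == 2^-1).
        by rewrite argA.
      by rewrite /H /= leNgt lt_neqAle eq_sym sn sl.
    * apply: (within_paste_le (u := fun x : R * V => `|x.2|) (c := 2^-1)
        (f := fun x : R * V => K (2 * x.1, 2 *: x.2))
        (g := fun x : R * V => h (x.1 * (2 * `|x.2| - 1), p x.2))) => //.
      - by cont.
      - by move=> [s t] [_ /= sl] /= tl; rewrite /H /= sl tl.
      - move=> [s t] [[/= s01 t1] /= sl] /= tl; rewrite /H /= sl.
        rewrite in_itv /= in s01.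
        case: ifPn => // tl'; have te : `|t| = 2^-1 by apply/le_anti/andP.
        have n2 : `|2 *: t| = 1 by rewrite norm2 te; lra.
        rewrite KB //=; last lra.
        rewrite Ah norm2 n2 /=; last lra.
        have n4 : `|(2 * 2) *: t| = 2 by rewrite normrZ te ger0_norm; lra.
        rewrite scalerA (push_scale (c := 2^-1)) ?te ?n4 //; olra.
        by rewrite /p (_ : s * _ = 2 - 2 * 1) //; lra.
      - apply: (within_comp (f := fun x : R * V => (2 * x.1, 2 *: x.2)) cK).
          by apply: continuous_subspaceT; cont.
        move=> [s t] [[[/= s01 t1] /= sl] /= tl]; rewrite in_itv /= in s01.
        by split; rewrite /= ?in_itv /unit_ball /= ?norm2; lra.
      - apply: (within_comp (f := fun x : R * V => (x.1 * (2 * `|x.2| - 1),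
        p x.2)) ch).
          apply: continuous_subspaceT; cont.
          by apply: (cont_comp cp); cont.
        move=> [s t] [[[/= s01 t1] /= sl] /= tl].
        rewrite in_itv /= in s01; rewrite /unit_ball /= in t1.
        split; last exact: p_ge.
        by rewrite /= in_itv /=; nra.
    * apply: (within_comp cA); first exact: continuous_subspaceT.
      move=> [s t] [[/= s01 t1] /= sl]; apply: arg2 => //.
      by rewrite in_itv /= in s01; lra.
  + move=> t t1; rewrite /H /= ifT; last lra.
    case: ifPn => [tl|]; last rewrite -ltNge => /ltW tl.
      rewrite mulr0 K0 ?/unit_ball/= ?norm2 ?p_le //; lra.
    by rewrite mul0r h0 /= ?b1b //; exact: p_ge.
  + move=> t t1; rewrite /H /= ifF; last by apply/negbTE; rewrite -ltNge; lra.
    rewrite /arg /= (_ : _ + _ = 1); last by lra.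
    by rewrite scale1r /A collar_ball.
  + move=> s t s01 t1; rewrite /H /=; rewrite /unit_ball/= in t1.
    case: ifPn => [sl|]; last first.
      by rewrite -ltNge => sl; apply: AO; apply: arg2 => //; lra.
    case: ifPn => [tl|]; last rewrite -ltNge => /ltW tl.
      by apply: KO; rewrite ?/unit_ball/= ?norm2; lra.
    apply: hO; last exact: p_ge.
    by nra.
- move=> s t s01 t1; rewrite /H /= /arg /= rate_ge t1; last lra.
  case: ifPn => [sl|].
    rewrite ifF; last by apply/negbTE; rewrite -ltNge; lra.
    rewrite /p push_sphere //; last lra.
    by congr (h (_, _)); lra.
  rewrite -ltNge => sl.
  have n : `|((2 - 2 * s) * ((5/2 - 1) / 1) + (2 * s - 1)) *: t| = 2 - s.
    by rewrite normrZ t1 ger0_norm; lra.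
  rewrite Ah n; last lra.
  rewrite (push_scale (c := 1)) ?n ?t1 ?push_sphere //; olra.
  by congr (h (_, _)); lra.
Qed.
Lemma ball_homotopy_lifting :
  rel_lifting R f O (unit_ball V) (unit_sphere V) ->
  homotopy_lifting R f O (unit_ball V) (unit_sphere V).
Proof.
move=> L a b h ca cb aO hb.
apply: (homotopy_lifting_of_rel cb _ ca aO hb) => a' ca' a'O fb.
by have [b' [H [? ? ? ?]]] := L a' b ca' cb a'O fb; exists b', H.
Qed.

Hypothesis cf : continuous f.

(** Solvability for all [a] depends only on the homotopy class of the boundary map. The problem with
    boundary [bs (1, t)] is solved relative to the homotopy obtained by running [f \o bs] from time
    0 to time 1; a collar carrying [bs] then brings the boundary values of the lift back to
    [bs (0, t)]. *)
Lemma rel_lifting_deform (bs : R * V -> Z) :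
  {within `[0, 1] `*` unit_sphere V, continuous bs} ->
  (forall (s : R) t, 0 <= s <= 1 -> unit_sphere V t -> O (f (bs (s, t)))) ->
  (forall a, {within unit_ball V, continuous a} ->
     (forall t, unit_ball V t -> O (a t)) ->
     (forall t, unit_sphere V t -> f (bs (1, t)) = a t) ->
     lifts_rel R f O (unit_ball V) (unit_sphere V) a (fun t => bs (1, t))) ->
  forall a, {within unit_ball V, continuous a} ->
     (forall t, unit_ball V t -> O (a t)) ->
     (forall t, unit_sphere V t -> f (bs (0, t)) = a t) ->
     lifts_rel R f O (unit_ball V) (unit_sphere V) a (fun t => bs (0, t)).
Proof.
move=> cbs bsO sol a ca aO fbs.
have cb1 : {within unit_sphere V, continuous (fun t => bs (1, t))}.
  apply: (within_comp (f := fun t : V => (1 : R, t)) cbs).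
    by apply: continuous_subspaceT; cont.
  by move=> t t1; split=> //; rewrite /= in_itv /=; lra.
have [|b1 [H [cH1 b1b [cH H0 H1 HO] HB]]] := homotopy_lifting_of_rel cb1 sol
    (h := fun x => f (bs (1 - x.1, x.2))) ca aO.
  split.
  - apply: (within_compl cf).
    apply: (within_comp (f := fun x : R * V => (1 - x.1, x.2)) cbs).
      by apply: continuous_subspaceT; cont.
    by move=> [s t] [/= + ?]; rewrite !in_itv /= => ?; split=> //=; lra.
  - by move=> t t1 /=; rewrite subr0.
  - by move=> t t1 /=; rewrite subrr fbs.
  - by move=> s t s01 t1 /=; apply: bsO => //; lra.
have norm2 (t : V) : `|2 *: t| = 2 * `|t| by rewrite normrZ ger0_norm.
have norms (s : R) (t : V) : 0 <= s <= 1 -> `|(2 - s) *: t| = (2 - s) * `|t|.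
  by move=> s01; rewrite normrZ ger0_norm //; lra.
have bs1 x : unit_sphere V x -> bs (1, x) = b1 x by move=> ?; rewrite b1b.
(* At time [s] only the collar up to radius [2 - s] is left. On its inner rim [bs] has time [1 - s],
   as prescribed for [H] on the sphere, and on its outer rim time 0. *)
pose G (x : R * V) := let v := (2 - x.1) *: x.2 in
  if `|v| <= 1 then H (x.1, v) else f (bs (2 - x.1 - `|v|, push 1 v)).
exists (fun t => collar b1 bs (2 *: t)), G; split.
- apply: (within_comp (f := fun t => 2 *: t) (continuous_collar cH1 cbs bs1)).
    by apply: continuous_subspaceT; cont.
  by move=> t; rewrite /unit_ball /= norm2; lra.
- move=> t t1; have n2 : `|2 *: t| = 2 by rewrite norm2 t1 mulr1.
  rewrite (collar_ge bs1) n2; last by lra.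
  by rewrite (push_scale (c := 1)) ?n2 ?t1 ?push_sphere ?subrr //; olra.
- split.
  + have cv : continuous (fun x : R * V => (2 - x.1) *: x.2) by cont.
    apply: (within_paste_le (u := fun x : R * V => `|(2 - x.1) *: x.2|) (c := 1)
      (f := fun x : R * V => H (x.1, (2 - x.1) *: x.2))
      (g := fun x : R * V => f (bs (2 - x.1 - `|(2 - x.1) *: x.2|,
                                 push 1 ((2 - x.1) *: x.2))))).
    * by cont.
    * by move=> [s t] [/= s01 t1] vl; rewrite /G /= vl.
    * move=> [s t] [/= s01 t1] vl; rewrite /G /=.
      rewrite in_itv /= in s01; case: ifPn => // vl'.
      have ve : `|(2 - s) *: t| = 1 by apply/le_anti/andP.
      by rewrite HB // push_sphere // ve /=; congr (f (bs (_, _))); lra.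
    * apply: (within_comp (f := fun x : R * V => (x.1, (2 - x.1) *: x.2)) cH).
        by apply: continuous_subspaceT; cont.
      by move=> [s t] [[/= s01 t1] /= vl].
    * apply: (within_compl cf).
      apply: (within_comp (f := fun x : R * V => (2 - x.1 - `|(2 - x.1) *: x.2|,
                                 push 1 ((2 - x.1) *: x.2))) cbs).
        apply: continuous_subspaceT; cont.
        by apply: (cont_comp _ cv); apply: continuous_push.
      move=> [s t] [[/= + t1] /= vl]; rewrite in_itv /= => s01.
      split; last exact: norm_push_ge.
      rewrite norms // in vl; rewrite /unit_ball /= in t1.
      by rewrite /= in_itv /= norms //; nra.
  + move=> t t1; rewrite /G /= !subr0 /collar.
    case: ifPn => [vl|]; first by rewrite H0.
    by rewrite -ltNge.
  + move=> t t1; rewrite /G /= (_ : 2 - 1 = 1); last lra.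
    by rewrite scale1r ifT // H1.
  + move=> s t s01 t1; rewrite /G /=.
    case: ifPn => [vl|]; first exact: HO.
    rewrite -ltNge => /ltW vl; apply: bsO; last exact: norm_push_ge.
    rewrite norms // in vl; rewrite /unit_ball /= in t1.
    by rewrite norms //; nra.
- move=> s t s01 t1; rewrite /G /=.
  have n : `|(2 - s) *: t| = 2 - s by rewrite norms // t1 mulr1.
  have pt : 2 - s >= 1 -> push 1 ((2 - s) *: t) = t.
    move=> ?; rewrite (push_scale (c := 1)) ?n ?t1 ?push_sphere //; olra.
  rewrite n; case: ifPn => sl; last first.
    by rewrite subrr pt ?fbs //; lra.
  have -> : s = 1 by lra.
  rewrite (_ : 2 - 1 = 1); last lra.
  by rewrite scale1r HB ?subrr ?fbs //; lra.
Qed.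

End RadialLifting.

(** * Grid subdivisions of the cube *)

Section RowVectors.
Context {R : realType}.

Lemma continuous_row (T : topologicalType) k (g : 'I_k -> T -> R) :
  (forall i, continuous (g i)) -> continuous (fun x => \row_i g i x).
Proof.
move=> cg x A [P /= gP PA].
have : \forall y \near x, forall i, P ord0 i (g i y).
  by apply: filter_forall => i; have := gP ord0 i; rewrite mxE; exact: cg.
by apply: filterS => y Py; apply: PA => i j; rewrite ord1 mxE.
Qed.

Lemma continuous_coord (T : topologicalType) k (g : T -> 'rV[R]_k) i :
  continuous g -> continuous (fun x => g x ord0 i).
Proof.
move=> cg; apply: (cont_comp (g := fun M : 'rV[R]_k => M ord0 i) _ cg).
exact: coord_continuous.
Qed.

Lemma rV_norm_leP k (t : 'rV[R]_k) c : 0 <= c ->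
  `|t| <= c <-> forall i, `|t ord0 i| <= c.
Proof.
move=> c0; have -> : `|t| = mx_norm t by []; rewrite mx_normrE; split.
  move=> tc i; apply: le_trans tc.
  exact: (le_bigmax _ (fun ij => `|t ij.1 ij.2|) (ord0, i)).
by move=> tc; apply/bigmax_leP; split=> // -[j i] _; rewrite ord1.
Qed.

Lemma rV_norm_eq1P k (t : 'rV[R]_k) :
  `|t| = 1 <-> `|t| <= 1 /\ exists i, `|t ord0 i| = 1.
Proof.
split=> [t1|[t1 [i ti]]]; last first.
  apply/eqP; rewrite eq_le t1 /= -{1}ti.
  by have /rV_norm_leP := lexx `|t|; exact.
split; first by rewrite t1.
have [|[j i] ti] := @mx_norm_neq0 _ _ _ t.
  by rewrite (_ : mx_norm t = `|t|) // t1 oner_eq0.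
by exists i; rewrite ord1 in ti; rewrite -ti.
Qed.

Lemma cube_compact k : compact (cube R k).
Proof.
have -> : cube R k = [set t | forall i, `[0, 1]%classic (t ord0 i)].
  by apply/seteqP; split => t /= h i; have := h i; rewrite /= in_itv.
by apply: (@rV_compact R k (fun=> `[0, 1]%classic)) => _;
  exact: segment_compact.
Qed.

(** The Lebesgue number of an open cover pulled back to the compact cube, in the form of the mesh of
    a grid. *)
Lemma cube_lebesgue k (W : topologicalType) (Os : set (set W))
    (a : 'rV[R]_k -> W) :
  (forall O, Os O -> open O) -> (forall w, exists2 O, Os O & O w) ->
  {within cube R k, continuous a} ->
  exists N, forall t, cube R k t -> exists2 O, Os O &
    forall y, cube R k y -> `|t - y| <= N.+1%:R^-1 -> O (a y).
Proof.
move=> Oopen Ocov /within_continuousP ca.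
have /compact_near_coveringP/(_ nat \oo%classic (fun N t => exists2 O, Os O &
    forall y, cube R k y -> `|t - y| <= N.+1%:R^-1 -> O (a y))) :=
      @cube_compact k.
case=> [t tc|N _ /(_ N (leqnn _)) cubeN]; last by exists N.
have [O OO Oa] := Ocov (a t).
have /nbhs_ballP [e /= e0 eO] := ca t tc O (open_nbhs_nbhs (conj (Oopen _ OO)
  Oa)).
(* One half of [e] bounds the distance from [t'] to the centre [t], the other half the mesh. *)
have e20 : 0 < e / 2 by rewrite divr_gt0.
exists (ball t (e / 2), [set N | N.+1%:R^-1 < e / 2]).
  split; first exact: nbhsx_ballx.
  exact: (near_infty_natSinv_lt (PosNum e20)).
move=> [t' N] [/= tt' Ne]; exists O => // y yc ty; apply: eO => //.
rewrite -ball_normE /ball_ /=.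
rewrite -ball_normE /ball_ /= in tt'.
rewrite (_ : t - y = (t - t') + (t' - y)); last by rewrite addrA subrK.
rewrite (splitr e); apply: le_lt_trans (ler_normD _ _) _.
by apply: ltrD => //; exact: le_lt_trans Ne.
Qed.

End RowVectors.

Section Faces.
Context (k N : nat).

(* The value [2 m] of a coordinate of a cell stands for the point [m / N],
   the value [2 m + 1] for the interval [[m / N, (m + 1) / N]]. *)
Definition cell := {ffun 'I_k -> 'I_N.*2.+1}.

Implicit Types e c : cell.

Definition face e e' := [forall i, (e i == e' i) ||
  odd (e' i) && (((e i).+1 == e' i) || (e i == (e' i).+1 :> nat))].

Definition on_boundary e := [exists i, (e i == 0 :> nat) || (e i == N.*2 :>
  nat)].

Definition top_cell e := [forall i, odd (e i)].

Lemma faceP e e' : reflect (forall i, e i = e' i :> nat \/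
  (odd (e' i) /\ ((e i).+1 = e' i \/ e i = (e' i).+1 :> nat))) (face e e').
Proof.
apply: (iffP forallP) => h i; have := h i.
  case/orP => [/eqP -> |/andP[o /orP[/eqP|/eqP]]]; [by left| |]; right; split;
    by [|left|right].
case=> [/val_inj ->|[-> [->|->]]]; by rewrite ?eqxx ?orbT.
Qed.

Lemma face_trans : transitive face.
Proof.
move=> e2 e1 e3 /faceP h12 /faceP h23; apply/faceP => i.
case: (h12 i) => [->|[o2 h1]]; first exact: h23.
case: (h23 i) => [e23|[o3 h2]]; first by rewrite -e23; right.
by lia.
Qed.

Lemma on_boundary_face e e' : face e e' -> on_boundary e' -> on_boundary e.
Proof.
move=> /faceP h /existsP[i bi]; apply/existsP; exists i.
by case: (h i) => [->//|[o _]]; lia.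
Qed.

Definition cell_dim e := #|[pred i | odd (e i)]|.

Lemma face_dim e e' : face e e' -> e != e' -> (cell_dim e < cell_dim e')%N.
Proof.
move=> /faceP h ne; apply: proper_card; apply/properP; split.
  apply/fintype.subsetP => i; rewrite !inE; case: (h i) => [->//|[o _]].
  by rewrite o.
have [i ni] : exists i, e i != e' i.
  apply/existsP; rewrite -negb_forall; apply: contra ne => /forallP hh.
  by apply/eqP/ffunP => i; apply/eqP.
have ni' : e i != e' i :> nat by [].
by exists i; rewrite !inE; case: (h i) => [ee|[o hi]]; lia.
Qed.

Lemma face_of_top e : (0 < N)%N -> exists2 c, top_cell c & face e c.
Proof.
(* A grid coordinate is widened to the interval below it, except 0, which has only the interval
   above. *)
move=> N0; pose m i := if odd (e i) then e i : nat else
  if e i == 0%N :> nat then 1%N else (e i).-1.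
have mN i : (m i < N.*2.+1)%N.
  by rewrite /m; have := ltn_ord (e i); repeat case: ifP; lia.
exists [ffun i => Ordinal (mN i)].
  by apply/forallP => i; rewrite ffunE /= /m; repeat case: ifP; lia.
apply/faceP => i; rewrite ffunE /= /m; repeat case: ifP; lia.
Qed.

End Faces.

(** * Cells as subsets of the cube *)

Section Cells.
Context {R : realType} (k N : nat).
Hypothesis N0 : (0 < N)%N.

Local Notation cell := (cell k N).
Implicit Types (e c : cell) (t : 'rV[R]_k).

Definition cell_lo e i : R := (e i)./2%:R / N%:R.
Definition cell_hi e i : R := (uphalf (e i))%:R / N%:R.

Definition cell_set e : set 'rV[R]_k :=
  [set t | forall i, cell_lo e i <= t ord0 i <= cell_hi e i].

Definition cell_boundary e : set 'rV[R]_k :=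
  [set t | cell_set e t /\
    exists i, odd (e i) /\ (t ord0 i = cell_lo e i \/ t ord0 i = cell_hi e i)].

Let NR : 0 < N%:R :> R.
Proof. by rewrite ltr0n. Qed.

Let NRn0 : N%:R != 0 :> R.
Proof. by rewrite gt_eqF. Qed.

Lemma cell_set_face e e' : face e e' -> cell_set e `<=` cell_set e'.
Proof.
move=> /faceP h t te i; move: (te i); rewrite /cell_lo /cell_hi.
rewrite !ler_pdivrMr // !ler_pdivlMr // => /andP[h1 h2].
suff /andP[h3 h4] : ((e' i)./2 <= (e i)./2)%N && (uphalf (e i) <= uphalf (e'
  i))%N.
  by rewrite (le_trans _ h1) ?(le_trans h2) // ler_nat.
by case: (h i) => [->|[o [oe|oe]]]; apply/andP; split; lia.
Qed.

Lemma cell_set_closed e : closed (cell_set e).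
Proof.
have -> : cell_set e = \bigcap_i ([set t : 'rV[R]_k | cell_lo e i <= t ord0 i]
  `&`
    [set t | t ord0 i <= cell_hi e i]).
  apply/seteqP; split => [t te i _|t te i]; first by split; have /andP[] :=
    te i.
  by have [/= -> ->] := te i I.
apply: closed_bigI => i _; apply: closedI; apply: closed_leP; cont;
  by apply: coord_continuous.
Qed.

Lemma cell_set_cube e : cell_set e `<=` cube R k.
Proof.
move=> t te i; have /andP[h1 h2] := te i; apply/andP; split.
  by apply: le_trans h1; rewrite divr_ge0.
apply: le_trans h2 _; rewrite ler_pdivrMr // mul1r ler_nat.
by have := ltn_ord (e i); lia.
Qed.

Let scaled e t i : cell_set e t ->
  (e i)./2%:R <= t ord0 i * N%:R <= (uphalf (e i))%:R.
Proof.
by move=> /(_ i); rewrite /cell_lo /cell_hi ler_pdivrMr // ler_pdivlMr.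
Qed.

(** Off the boundary of [e], [t] is strictly inside the interval in every odd coordinate of [e], so
    [e'] has the same interval there; in an even coordinate [t] is a grid point, which belongs only
    to that value and the two adjacent ones. *)
Lemma face_meet e e' t : cell_set e t -> cell_set e' t ->
  ~ cell_boundary e t -> face e e'.
Proof.
move=> te te' nb; apply/faceP => i.
have /andP[h1 h2] := scaled i te; have /andP[h3 h4] := scaled i te'.
have le1 : ((e i)./2 <= uphalf (e' i))%N by rewrite -(ler_nat R) (le_trans h1).
have le2 : ((e' i)./2 <= uphalf (e i))%N by rewrite -(ler_nat R) (le_trans h3).
have [o|o] := boolP (odd (e i)); last by lia.
have lo i' : odd (e i') -> t ord0 i' != cell_lo e i'.
  move=> o'; apply/eqP => tl; apply: nb; split=> //; exists i'; split=> //.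
  by left.
have hi i' : odd (e i') -> t ord0 i' != cell_hi e i'.
  move=> o'; apply/eqP => tl; apply: nb; split=> //; exists i'; split=> //.
  by right.
have lt1 : ((e i)./2 < uphalf (e' i))%N.
  rewrite -(ltr_nat R) (lt_le_trans _ h4) // lt_neqAle h1 andbT.
  have := lo i o; apply: contraNneq => eq1.
  by rewrite /cell_lo eq1 mulfK.
have lt2 : ((e' i)./2 < uphalf (e i))%N.
  rewrite -(ltr_nat R) (le_lt_trans h3) // lt_neqAle h2 andbT.
  have := hi i o; apply: contraNneq => eq1.
  by rewrite /cell_hi -eq1 mulfK.
by lia.
Qed.

Lemma cell_boundary_face e t : cell_boundary e t ->
  exists2 e', face e' e /\ e' != e & cell_set e' t.
Proof.
move=> [te [i0 [o ti]]].
have [m me tm] : exists2 m, (m.+1 = e i0 \/ m = (e i0).+1)%N &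
    t ord0 i0 * N%:R = m./2%:R /\ ~~ odd m.
  case: ti => ti; [exists (e i0).-1 | exists (e i0).+1].
  - by lia.
  - rewrite ti /cell_lo divfK //; split; last by lia.
    by congr (_%:R); lia.
  - by lia.
  - rewrite ti /cell_hi divfK //; split; last by lia.
    by congr (_%:R); lia.
have mN : (m < N.*2.+1)%N by have := ltn_ord (e i0); lia.
pose e' : cell := [ffun i => if i == i0 then inord m else e i].
have e'0 : e' i0 = m :> nat by rewrite ffunE eqxx inordK.
have e'i i : i != i0 -> e' i = e i by rewrite ffunE => /negbTE ->.
exists e'; [split|].
- apply/faceP => i; have [->|/e'i ->] := eqVneq i i0; last by left.
  by right; split=> //; rewrite e'0.
- by apply/eqP => /(congr1 (fun e : cell => e i0 : nat)); rewrite e'0; lia.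
- move=> i; have [->|ni] := eqVneq i i0; last first.
    by rewrite /cell_lo /cell_hi (e'i _ ni); exact: te.
  case: tm => tm om; rewrite /cell_lo /cell_hi e'0.
  rewrite ler_pdivrMr // ler_pdivlMr // tm lexx /= ler_nat; lia.
Qed.

Lemma cell_boundary_set e : cell_boundary e `<=` cell_set e.
Proof. by move=> t []. Qed.

Lemma on_boundary_set e : on_boundary e -> cell_set e `<=` cube_boundary R k.
Proof.
move=> /existsP[i h] t te; split; first exact: cell_set_cube te.
exists i; have /andP[h1 h2] := scaled i te.
case/orP: h => /eqP h; rewrite h ?doubleK ?uphalf_double in h1 h2.
  left; have /eqP : t ord0 i * N%:R = 0 by apply/le_anti/andP.
  by rewrite mulf_eq0 (negbTE NRn0) orbF => /eqP.
right; have h3 : t ord0 i * N%:R = 1 * N%:R by rewrite mul1r;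
  apply/le_anti/andP.
by apply: mulIf h3.
Qed.

(** A coordinate 0 or 1 of [t] cannot come from an even value of [e], which would be 0 or 2N and put
    [e] on the boundary; so it is an endpoint of an interval of [e]. *)
Lemma off_boundary e t : ~~ on_boundary e -> cell_set e t ->
  cube_boundary R k t -> cell_boundary e t.
Proof.
move=> nb te [_ [i ti]]; split=> //; exists i.
have : ~~ ((e i == 0 :> nat) || (e i == N.*2 :> nat)).
  by apply: contra nb => h; apply/existsP; exists i.
rewrite negb_or => /andP[n0 nN]; have /andP[h1 h2] := scaled i te.
have := ltn_ord (e i); rewrite ltnS => eN.
case: ti => ti; rewrite ti ?mul0r ?mul1r in h1 h2.
  have h3 : ((e i)./2 <= 0)%N by rewrite -(ler_nat R).
  split; first by lia.
  left; rewrite ti /cell_lo (_ : (e i)./2 = 0%N) ?mul0r //; lia.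
have h3 : (N <= uphalf (e i))%N by rewrite -(ler_nat R).
split; first by lia.
right; rewrite ti /cell_hi (_ : uphalf (e i) = N) ?divff //; lia.
Qed.

Lemma cube_top_cell t : cube R k t -> exists2 e, top_cell e & cell_set e t.
Proof.
move=> tc.
(* The truncation is [N] when the coordinate is 1; the minimum assigns this point to the last
   interval. *)
pose m i := minn (Num.trunc (t ord0 i * N%:R)) N.-1.
have mN i : ((m i).*2.+1 < N.*2.+1)%N by rewrite /m; lia.
exists [ffun i => Ordinal (mN i)].
  by apply/forallP => i; rewrite ffunE /= odd_double.
move=> i; rewrite /cell_lo /cell_hi ffunE /= uphalf_double doubleK.
have /andP[t0 t1] := tc i.
have tN0 : 0 <= t ord0 i * N%:R by rewrite mulr_ge0.
have tN1 : t ord0 i * N%:R <= N%:R by rewrite ler_piMl.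
have /andP[h1 h2] := truncn_itv tN0.
rewrite ler_pdivrMr // ler_pdivlMr //; apply/andP; split.
  by apply: le_trans h1; rewrite ler_nat geq_minl.
have [h|h] := leqP (Num.trunc (t ord0 i * N%:R)) N.-1.
  by rewrite /m (minn_idPl h) ltW.
rewrite /m (minn_idPr (ltnW h)); apply: le_trans tN1 _; rewrite ler_nat; lia.
Qed.

Lemma cell_set_diam c t y : top_cell c -> cell_set c t -> cell_set c y ->
  `|t - y| <= N%:R^-1.
Proof.
move=> ctop ct cy; apply/rV_norm_leP; first by rewrite invr_ge0.
move=> i; rewrite !mxE; have /andP[h1 h2] := ct i; have /andP[h3 h4] := cy i.
have o := forallP ctop i.
have : cell_hi c i = cell_lo c i + N%:R^-1.
  rewrite /cell_hi /cell_lo (_ : uphalf (c i) = (c i)./2.+1); last by lia.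
  by rewrite -natr1 mulrDl mul1r.
by move=> hE; rewrite ler_norml; lra.
Qed.

End Cells.

(** * Lifting properties are local *)

Section LocalToGlobal.
Context {R : realType}.

Section CellBall.
Context (k N : nat).
Hypothesis N0 : (0 < N)%N.
Variable e : cell k N.

Let NR : 0 < N%:R :> R.
Proof. by rewrite ltr0n. Qed.

Let NRn0 : N%:R != 0 :> R.
Proof. by rewrite gt_eqF. Qed.

Let A := [pred i | odd (e i)].

(** The norm of row vectors is the maximum norm, so the unit ball is a cube: a cell is carried
    affinely onto the ball with one coordinate for each odd coordinate of [e]. *)
Let to_ball (t : 'rV[R]_k) : 'rV[R]_#|A| :=
  \row_l (2 * N%:R * (t ord0 (enum_val l) - cell_lo e (enum_val l)) - 1).

Let of_ball (u : 'rV[R]_#|A|) : 'rV[R]_k :=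
  \row_i (cell_lo e i + if [pick l | enum_val l == i] is Some l
    then (u ord0 l + 1) * (2 * N%:R)^-1 else 0).

Let hi_lo i : odd (e i) -> cell_hi e i = cell_lo e i + N%:R^-1 :> R.
Proof.
move=> o; rewrite /cell_hi /cell_lo (_ : uphalf (e i) = (e i)./2.+1);
  last by lia.
by rewrite -natr1 mulrDl mul1r.
Qed.

Let hi_lo_even i : ~~ odd (e i) -> cell_hi e i = cell_lo e i :> R.
Proof. by move=> o; rewrite /cell_hi /cell_lo; congr (_%:R / _); lia. Qed.

Let of_ball_val u l :
  of_ball u ord0 (enum_val l) =
  cell_lo e (enum_val l) + (u ord0 l + 1) * (2 * N%:R)^-1.
Proof.
rewrite mxE; case: pickP => [l' /eqP /enum_val_inj -> //|].
by move=> /(_ l); rewrite eqxx.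
Qed.

Let of_ball_even u i : ~~ odd (e i) -> of_ball u ord0 i = cell_lo e i.
Proof.
move=> o; rewrite mxE; case: pickP => [l /eqP li|_]; last by rewrite addr0.
by have := enum_valP l; rewrite li inE (negbTE o).
Qed.

Let odd_enum i : odd (e i) -> exists l : 'I_#|A|, enum_val l = i.
Proof.
by move=> o; exists (enum_rank_in (o : i \in A) i); rewrite enum_rankK_in.
Qed.

Let oddE l : odd (e (@enum_val _ A l)).
Proof. by have := enum_valP l. Qed.

Let invN : 0 < N%:R^-1 :> R.
Proof. by rewrite invr_gt0. Qed.

Let inv2N : (2 * N%:R)^-1 = N%:R^-1 / 2 :> R.
Proof. by rewrite invfM mulrC. Qed.

Let half_step (u : R) : -1 <= u <= 1 -> 0 <= (u + 1) * (N%:R^-1 / 2) <= N%:R^-1.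
Proof.
move=> u1; have := invN; move: (N%:R^-1) => x x0.
have h1 : 0 <= (u + 1) * x by apply: mulr_ge0; lra.
have h2 : 0 <= (1 - u) * x by apply: mulr_ge0; lra.
by lra.
Qed.

Lemma cell_homotopy_lifting (Z W : topologicalType) (f : Z -> W) (O : set W) :
  homotopy_lifting R f O (unit_ball 'rV[R]_#|A|) (unit_sphere 'rV[R]_#|A|) ->
  homotopy_lifting R f O (@cell_set R _ _ e) (@cell_boundary R _ _ e).
Proof.
apply: (homotopy_lifting_retract (p := to_ball) (q := of_ball)).
- apply: continuous_row => l; cont.
  exact: coord_continuous.
- apply: continuous_row => i; case: pickP => [l _|_]; cont.
  exact: coord_continuous.
- move=> t te; apply/rV_norm_leP => // l; rewrite mxE.
  have := te (enum_val l); rewrite (hi_lo (oddE l)).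
  set x := t _ _ - _ => tl.
  have [x0 x1] : 0 <= x /\ x <= N%:R^-1 by rewrite /x; lra.
  have x2 : N%:R * x <= 1 by rewrite mulrC -ler_pdivlMr // mul1r.
  have x3 : 0 <= N%:R * x by rewrite mulr_ge0.
  by rewrite ler_norml; lra.
- move=> t [te [i [o ti]]]; have [l li] := odd_enum o; subst i.
  apply/rV_norm_eq1P; split.
    apply/rV_norm_leP => // l'; rewrite mxE.
    have := te (enum_val l'); rewrite (hi_lo (oddE l')).
    set x := t _ _ - _ => tl.
    have [x0 x1] : 0 <= x /\ x <= N%:R^-1 by rewrite /x; lra.
    have x2 : N%:R * x <= 1 by rewrite mulrC -ler_pdivlMr // mul1r.
    have x3 : 0 <= N%:R * x by rewrite mulr_ge0.
    by rewrite ler_norml; lra.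
  exists l; rewrite mxE; case: ti => ->.
    by rewrite subrr mulr0 sub0r normrN1.
  rewrite (hi_lo o) addrAC subrr add0r mulfK // (_ : 2 - 1 = 1) ?normr1 //; lra.
- move=> u u1 i; have [o|o] := boolP (odd (e i)); last first.
    by rewrite of_ball_even // hi_lo_even // lexx.
  have [l li] := odd_enum o; subst i; rewrite of_ball_val hi_lo // inv2N.
  have /rV_norm_leP : `|u| <= 1 by []; move=> /(_ ler01 l); rewrite ler_norml.
  by move=> /half_step; lra.
- move=> u u1; have u1' : `|u| <= 1 by rewrite u1.
  have /rV_norm_leP h := u1'.
  have /rV_norm_eq1P [_ [l ul]] := u1; split.
    move=> i; have [o|o] := boolP (odd (e i)); last first.
      by rewrite of_ball_even // hi_lo_even // lexx.
    have [l' li] := odd_enum o; subst i; rewrite of_ball_val hi_lo // inv2N.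
    have := h ler01 l'; by rewrite ler_norml => /half_step; lra.
  exists (enum_val l); split; first exact: oddE.
  rewrite of_ball_val hi_lo // inv2N.
  move: ul; have [u0|u0] := lerP 0 (u ord0 l) => ul.
    by right; congr (_ + _); rewrite ger0_norm // in ul; rewrite ul; lra.
  rewrite ltr0_norm // in ul; left.
  by rewrite (_ : u ord0 l = -1) ?addNr ?mul0r ?addr0 //; lra.
- move=> t te; apply/rowP => i.
  have [o|o] := boolP (odd (e i)); last first.
    rewrite of_ball_even //; have := te i; rewrite hi_lo_even //.
    by move=> h; apply/le_anti.
  have [l li] := odd_enum o; subst i; rewrite of_ball_val mxE subrK.
  by rewrite mulrC mulKf ?mulf_neq0 // addrC subrK.
- exact: cell_boundary_set.
Qed.

End CellBall.

(** * Lifting cell by cell *)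

Section Subdivision.
Variables (Z W : topologicalType) (f : Z -> W).
Hypothesis cf : continuous f.
Variable Os : set (set W).
Hypothesis OsI : forall O O', Os O -> Os O' -> Os (O `&` O').
Hypothesis liftO : forall O, Os O -> forall j,
  rel_lifting R f O (unit_ball 'rV[R]_j) (unit_sphere 'rV[R]_j).

Let Os_all (I : finType) (P : pred I) (F : I -> set W) (i0 : I) : P i0 ->
  (forall i, Os (F i)) -> Os [set w | forall i, P i -> F i w].
Proof.
move=> Pi0 FO.
(* Keeping the factor [F i0] makes the empty case a member of [Os], which is closed only under
   binary intersections. *)
suff H (s : seq I) : Os [set w | F i0 w /\ forall i, i \in s -> P i -> F i w].
  have := H (enum I); congr Os; apply/seteqP; split => w /=.
    by move=> [_ h] i; apply: h; rewrite mem_enum.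
  by move=> h; split=> [|i _]; exact: h.
elim: s => [|i s IH].
  have := FO i0; congr Os; apply/seteqP; split => w //=.
  by case.
have [Pi|Pi] := boolP (P i).
  have := OsI (FO i) IH; congr Os; apply/seteqP; split => w /=.
    move=> [Fi [F0 h]]; split=> // j; rewrite inE => /orP[/eqP -> //|];
      exact: h.
  move=> [F0 h]; split; first by apply: h => //; rewrite inE eqxx.
  by split=> // j js; apply: h; rewrite inE js orbT.
have := IH; congr Os; apply/seteqP; split => w /= [F0 h]; split=> // j.
  by rewrite inE => /orP[/eqP ->|/h //]; rewrite (negbTE Pi).
by move=> js; apply: h; rewrite inE js orbT.
Qed.

Context (k N : nat).
Hypothesis N0 : (0 < N)%N.
Variables (a : 'rV[R]_k -> W) (b : 'rV[R]_k -> Z).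
Hypothesis ca : {within cube R k, continuous a}.
Hypothesis cb : {within cube_boundary R k, continuous b}.
Hypothesis fb : forall t, cube_boundary R k t -> f (b t) = a t.
Hypothesis small : forall c : cell k N, top_cell c ->
  exists2 O, Os O & forall t, cell_set c t -> O (a t).

Let Oc_ex : exists Oc : cell k N -> set W, forall c, Os (Oc c) /\
  (top_cell c -> forall t, cell_set c t -> Oc c (a t)).
Proof.
have /choice [Oc h] : forall c : cell k N, exists O, Os O /\
    (top_cell c -> forall t, cell_set c t -> O (a t)); last by exists Oc.
move=> c; have [tc|tc] := boolP (top_cell c).
  by have [O OO Oa] := small tc; exists O.
(* Cells of smaller dimension receive an arbitrary member of [Os], borrowed from a top cell. *)
have [c' tc' _] := face_of_top c N0.
by have [O OO _] := small tc'; exists O.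
Qed.

Let Oc := sval (cid Oc_ex).

(* For a cell [e'] of the boundary of [e], more top cells contain [e'] than
   contain [e]: hence [cell_open e'] is smaller than [cell_open e]. *)
Let cell_open (e : cell k N) : set W :=
  [set w | forall c, top_cell c && face e c -> Oc c w].

Let cell_openO e : Os (cell_open e).
Proof.
have [c tc ec] := face_of_top e N0; apply: (@Os_all _ _ _ c).
  by rewrite tc.
by move=> c'; have [] := svalP (cid Oc_ex) c'.
Qed.

Let cell_open_face e e' : face e e' -> cell_open e `<=` cell_open e'.
Proof.
move=> ee' w we c /andP[tc ec]; apply: we; rewrite tc /=.
exact: face_trans ee' ec.
Qed.

Let cell_open_a e t : cell_set e t -> cell_open e (a t).
Proof.
move=> te c /andP[tc ec]; have [_ h] := svalP (cid Oc_ex) c.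
by apply: h => //; exact: cell_set_face ec t te.
Qed.

Let union (S : {set cell k N}) : set 'rV[R]_k :=
  [set t | exists2 e, e \in S & cell_set e t].

Let union_closed S : closed (union S).
Proof.
have -> : union S = \big[setU/set0]_(e <- enum S) @cell_set R _ _ e.
  rewrite -bigcup_seq; apply/seteqP; split => t /= [e h te]; exists e => //=;
  by move: h; rewrite /= mem_enum.
by apply: closed_bigsetU => e _; exact: cell_set_closed.
Qed.

Let union_cube S t : union S t -> cube R k t.
Proof. by move=> [e _]; exact: cell_set_cube. Qed.

(** Induction on the number of cells of a subcomplex [S] containing the boundary of the cube. The
    last clause carries the induction: the homotopy over the faces of a new cell stays in their open
    sets, hence in the larger open set of that cell. *)
Lemma grid_lifting (S : {set cell k N}) :
  (forall e, on_boundary e -> e \in S) ->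
  (forall e e', face e e' -> e' \in S -> e \in S) ->
  exists b' H,
    [/\ {within union S, continuous b'},
        forall t, union S t -> cube_boundary R k t -> b' t = b t,
        homotopy_in setT (union S) H (f \o b') a,
        forall (s : R) t, 0 <= s <= 1 -> union S t -> cube_boundary R k t ->
          H (s, t) = a t &
        forall (s : R) t e, 0 <= s <= 1 -> e \in S -> cell_set e t ->
          cell_open e (H (s, t))].
Proof.
have [n] := ubnP #|S|; elim: n S => // n IH S /ltnSE Sn bS fS.
have [Sb|[e0]] : (forall e, e \in S -> on_boundary e) \/
    exists e, (e \in S) && ~~ on_boundary e.
  have [/existsP|/existsPn h] := boolP [exists e,
    (e \in S) && ~~ on_boundary e].
    by right.
  by left => e eS; have := h e; rewrite eS /= negbK.
- have Scb t : union S t -> cube_boundary R k t.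
    by move=> [e /Sb eb]; exact: on_boundary_set.
  exists b, (a \o snd); split => //.
  + exact: continuous_subspaceW cb.
  + split=> //.
    * apply: (within_comp (f := snd) ca).
        by apply: continuous_subspaceT => x; exact: cvg_snd.
      by move=> [s t] [_ /= /union_cube].
    * by move=> t /Scb /fb /= ->.
  + by move=> s t e _ _ te; exact: cell_open_a.
move=> Pe0.
(* Of maximal dimension off the boundary, [e] is a proper face of no cell of [S]; so removing it
   leaves a subcomplex. *)
case: (@arg_maxnP _ e0 (fun e => (e \in S) && ~~ on_boundary e) (@cell_dim k N)
  Pe0) => e /andP[eS eb] emax.
pose S' := (S :\ e)%SET.
have fS' e1 e2 : face e1 e2 -> e2 \in S' -> e1 \in S'.
  rewrite !finset.in_setD1 => e12 /andP[ne2 e2S].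
  rewrite (fS _ _ e12) // andbT; apply: contra_neq ne2 => e1e; subst e1.
  apply/esym/eqP; apply: contraT => /(face_dim e12).
  have : (cell_dim e2 <= cell_dim e)%N; last by lia.
  apply: emax; rewrite e2S /=; apply: contra eb.
  exact: on_boundary_face.
have bS' e1 : on_boundary e1 -> e1 \in S'.
  move=> be1; rewrite finset.in_setD1 bS // andbT.
  by apply: contraNneq eb => <-.
have [|b1 [H1 [cb1 b1b [cH1 H10 H11 _] H1b H1O]]] := IH S' _ bS' fS'.
  by apply: leq_trans Sn; rewrite [leqRHS](cardsD1 e) eS.
have bdS' t : cell_boundary e t -> union S' t.
  move=> /(cell_boundary_face N0) [e' [fe' ne'] te']; exists e' => //.
  by rewrite finset.in_setD1 ne' (fS _ _ fe').
have eS'bd t : cell_set e t -> union S' t -> cell_boundary e t.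
  move=> te [e' e'S' te']; apply: contrapT => /(face_meet N0 te te') ee'.
  by have := fS' _ _ ee' e'S'; rewrite finset.in_setD1 eqxx.
have SU t : union S t -> union S' t \/ cell_set e t.
  move=> [e' e'S te']; have [ee'|ne'] := eqVneq e' e.
    by right; rewrite -ee'.
  by left; exists e' => //; rewrite finset.in_setD1 ne'.
have := cell_homotopy_lifting N0
  (ball_homotopy_lifting (liftO (cell_openO e) (j := _))).
case/(_ k e a b1 H1) => [||||b2 [H2 [cb2 b2b [cH2 H20 H21 H2O] H2b]]].
- by apply: continuous_subspaceW ca => t; exact: cell_set_cube.
- exact: continuous_subspaceW cb1.
- by move=> t; exact: cell_open_a.
- split.
  + apply: continuous_subspaceW cH1 => -[s t] [/= s01 tb].
    by split=> //; exact: bdS'.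
  + by move=> t /bdS'; exact: H10.
  + by move=> t /bdS'; exact: H11.
  + move=> s t s01 /(cell_boundary_face N0) [e' [fe' ne'] te'].
    apply: (cell_open_face fe'); apply: H1O => //.
    by rewrite finset.in_setD1 ne' (fS _ _ fe').
(* The cell meets the remaining cells exactly in its boundary, where the new lift and homotopy
   extend the old ones. *)
pose b3 t := if `[< union S' t >] then b1 t else b2 t.
pose H3 (x : R * 'rV[R]_k) := if `[< union S' x.2 >] then H1 x else H2 x.
have b3S t : union S' t -> b3 t = b1 t by rewrite /b3; case: asboolP.
have b3e t : cell_set e t -> b3 t = b2 t.
  by rewrite /b3; case: asboolP => // tS te; rewrite b2b //; exact: eS'bd.
have H3S s t : union S' t -> H3 (s, t) = H1 (s, t).
  by rewrite /H3 /=; case: asboolP.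
have H3e (s : R) t : 0 <= s <= 1 -> cell_set e t -> H3 (s, t) = H2 (s, t).
  rewrite /H3 /=; case: asboolP => // tS s01 te.
  by rewrite H2b //; exact: eS'bd.
exists b3, H3; split.
- apply: (within_paste (M := union S') (N := @cell_set R _ _ e)
    (f := b1) (g := b2)) => //.
  + exact: cell_set_closed.
  + by move=> t _; exact: b3S.
  + by move=> t _; exact: b3e.
  + by apply: continuous_subspaceW cb1 => t [].
  + by apply: continuous_subspaceW cb2 => t [].
- move=> t /SU [tS'|te] tb; first by rewrite b3S // b1b.
  have tb' : cell_boundary e t by exact: off_boundary te tb.
  by rewrite b3e // b2b // b1b //; exact: bdS'.
- split => //.
  + apply: (within_paste (M := [set x : R * 'rV[R]_k | union S' x.2])
      (N := [set x : R * 'rV[R]_k | cell_set e x.2]) (f := H1) (g := H2)).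
    * by apply: (@closed_comp _ _ snd) => // x _; exact: cvg_snd.
    * apply: (@closed_comp _ _ snd); last exact: cell_set_closed.
      by move=> x _; exact: cvg_snd.
    * by move=> [s t] [_ /= /SU].
    * by move=> [s t] _ /=; exact: H3S.
    * by move=> [s t] [/= + _] /=; rewrite in_itv /=; exact: H3e.
    * by apply: continuous_subspaceW cH1 => -[s t] [[/= ? _] /= ?].
    * by apply: continuous_subspaceW cH2 => -[s t] [[/= ? _] /= ?].
  + move=> t /SU [tS'|te]; first by rewrite H3S //= b3S // H10.
    by rewrite H3e ?lexx ?ler01 //= b3e // H20.
  + move=> t /SU [tS'|te]; first by rewrite H3S // H11.
    by rewrite H3e ?lexx ?ler01 // H21.
- move=> s t s01 /SU [tS'|te] tb; first by rewrite H3S // H1b.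
  have tb' : cell_boundary e t by exact: off_boundary te tb.
  by rewrite H3e // H2b // H1b //; exact: bdS'.
- move=> s t e' s01 e'S te'; have [ee'|ne'] := eqVneq e' e.
    by subst e'; rewrite H3e //; exact: H2O.
  have e'S' : e' \in S' by rewrite finset.in_setD1 ne'.
  by rewrite H3S; [exact: H1O|exists e'].
Qed.

End Subdivision.

Lemma cube_ball_retract (k : nat) (Z W : topologicalType) (f : Z -> W)
    (O : set W) :
  rel_lifting R f O (unit_ball 'rV[R]_k) (unit_sphere 'rV[R]_k) <->
  rel_lifting R f O (cube R k) (cube_boundary R k).
Proof.
pose p (t : 'rV[R]_k) : 'rV[R]_k := \row_i (2 * t ord0 i - 1).
pose q (t : 'rV[R]_k) : 'rV[R]_k := \row_i ((t ord0 i + 1) / 2).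
have cp : continuous p.
  by apply: continuous_row => i; cont; exact: coord_continuous.
have cq : continuous q.
  by apply: continuous_row => i; cont; exact: coord_continuous.
have pA t : cube R k t -> unit_ball 'rV[R]_k (p t).
  move=> tc; apply/rV_norm_leP => // i; rewrite mxE ler_norml.
  by have := tc i; lra.
have qA t : unit_ball 'rV[R]_k t -> cube R k (q t).
  move=> t1 i; have := iffLR (rV_norm_leP t ler01) t1 i.
  by rewrite mxE ler_norml; lra.
have pB t : cube_boundary R k t -> unit_sphere 'rV[R]_k (p t).
  move=> [tc [i ti]]; apply/rV_norm_eq1P; split; first exact: pA.
  exists i; rewrite mxE; case: ti => ->; first by rewrite mulr0 sub0r normrN1.
  by rewrite (_ : _ - 1 = 1) ?normr1; lra.
have qB t : unit_sphere 'rV[R]_k t -> cube_boundary R k (q t).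
  move=> t1; have [t1' [i ti]] := iffLR (rV_norm_eq1P _) t1.
  split; first exact: qA.
  exists i; rewrite mxE; move: ti; have [u0|u0] := lerP 0 (t ord0 i) => ti.
    by right; rewrite ger0_norm // in ti; rewrite ti; lra.
  by left; rewrite ltr0_norm // in ti; lra.
split.
- apply: (rel_lifting_retract cp cq pA pB qA qB); last by move=> t [].
  by move=> t _; apply/rowP => i; rewrite !mxE; lra.
- apply: (rel_lifting_retract cq cp qA qB pA pB); last exact: unit_sphere_ball.
  by move=> t _; apply/rowP => i; rewrite !mxE; lra.
Qed.

Theorem rel_lifting_local (Z W : topologicalType) (f : Z -> W)
    (Os : set (set W)) :
  (forall O, Os O -> open O) -> (forall w, exists2 O, Os O & O w) ->
  (forall O O', Os O -> Os O' -> Os (O `&` O')) ->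
  (forall O, Os O -> forall j,
    rel_lifting R f O (unit_ball 'rV[R]_j) (unit_sphere 'rV[R]_j)) ->
  forall k, rel_lifting R f setT (unit_ball 'rV[R]_k) (unit_sphere 'rV[R]_k).
Proof.
move=> Oopen Ocov OI OL k; apply/cube_ball_retract => a b ca cb _ fb.
have [N cubeN] := cube_lebesgue Oopen Ocov ca.
have small (c : cell k N.+1) : top_cell c ->
    exists2 O, Os O & forall t, cell_set c t -> O (a t).
  (* The lower corner represents the cell: in the maximum norm all its points are within one mesh of
     the corner. *)
  move=> ctop; pose t : 'rV[R]_k := \row_i cell_lo c i.
  have ct : cell_set c t.
    move=> i; rewrite mxE lexx /= ler_pM2r ?invr_gt0 ?ltr0n // ler_nat; lia.
  have [O OO Oa] := cubeN t (cell_set_cube (ltn0Sn N) ct).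
  exists O => // y cy; apply: Oa; first exact: (cell_set_cube (ltn0Sn N) cy).
  exact: (cell_set_diam (ltn0Sn N) ctop).
have [e _|e e' _ _|b' [H [cb' bb' [cH H0 H1 HO] HB _]]] :=
    grid_lifting OI OL (ltn0Sn N) ca cb fb small (S := finset.setT).
- exact: finset.in_setT.
- exact: finset.in_setT.
have cU t : cube R k t -> exists2 e : cell k N.+1,
  e \in finset.setT & cell_set e t.
  move=> /(cube_top_cell (ltn0Sn N)) [e _ te]; exists e => //.
  by rewrite finset.in_setT.
exists b', H; split.
- by apply: continuous_subspaceW cb' => t; exact: cU.
- by move=> t tb; apply: bb' => //; apply: cU; case: tb.
- split=> //.
  + by apply: continuous_subspaceW cH => -[s t] [/= ? /cU].
  + by move=> t tc; apply: H0; exact: cU.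
  + by move=> t tc; apply: H1; exact: cU.
- by move=> s t s01 tb; apply: HB => //; apply: cU; case: tb.
Qed.

End LocalToGlobal.

(** * Weak homotopy equivalences and lifting properties *)

Section HomotopyRelations.
Context {R : realType}.

Section Concatenation.
Context {T S : topologicalType} (A : set T).
Implicit Types H : R * T -> S.

Lemma homotopy_reverse H : {within `[0, 1] `*` A, continuous H} ->
  {within `[0, 1] `*` A, continuous (fun x => H (1 - x.1, x.2))}.
Proof.
move=> cH; apply: (within_comp (f := fun x : R * T => (1 - x.1, x.2)) cH).
  by apply: continuous_subspaceT; cont.
by move=> [s t] [/= + At]; rewrite in_itv /= => s01; split=> //=;
  rewrite in_itv /=; lra.
Qed.

Definition homotopy_concat H1 H2 (x : R * T) : S :=
  if x.1 <= 2^-1 then H1 (2 * x.1, x.2) else H2 (2 * x.1 - 1, x.2).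

Lemma homotopy_concatl H1 H2 s t : s <= 2^-1 ->
  homotopy_concat H1 H2 (s, t) = H1 (2 * s, t).
Proof. by rewrite /homotopy_concat /= => ->. Qed.

Lemma homotopy_concatr H1 H2 s t : A t ->
  (forall t, A t -> H1 (1, t) = H2 (0, t)) -> 2^-1 <= s ->
  homotopy_concat H1 H2 (s, t) = H2 (2 * s - 1, t).
Proof.
move=> At H12 s2; rewrite /homotopy_concat /=; case: ifPn => // s2'.
have -> : s = 2^-1 by apply/le_anti/andP.
rewrite (_ : 2 * 2^-1 = 1); last by lra.
by rewrite H12 // subrr.
Qed.

Lemma homotopy_concat_continuous H1 H2 :
  {within `[0, 1] `*` A, continuous H1} ->
  {within `[0, 1] `*` A, continuous H2} ->
  (forall t, A t -> H1 (1, t) = H2 (0, t)) ->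
  {within `[0, 1] `*` A, continuous (homotopy_concat H1 H2)}.
Proof.
move=> c1 c2 H12.
apply: (within_paste_le (u := fun x : R * T => x.1) (c := 2^-1)
  (f := fun x => H1 (2 * x.1, x.2)) (g := fun x => H2 (2 * x.1 - 1, x.2))).
- by cont.
- by move=> [s t] [/= s01 At]; exact: homotopy_concatl.
- by move=> [s t] [/= s01 At]; exact: homotopy_concatr.
- apply: (within_comp (f := fun x : R * T => (2 * x.1, x.2)) c1).
    by apply: continuous_subspaceT; cont.
  move=> [s t] [[/= + At] /= s2]; rewrite !in_itv /= => s01.
  by split=> //=; lra.
- apply: (within_comp (f := fun x : R * T => (2 * x.1 - 1, x.2)) c2).
    by apply: continuous_subspaceT; cont.
  move=> [s t] [[/= + At] /= s2]; rewrite !in_itv /= => s01.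
  by split=> //=; lra.
Qed.

End Concatenation.

Section Spheroids.
Context {Z : topologicalType} {k : nat}.
Implicit Types (z : Z) (a b c : 'rV[R]_k -> Z).

Lemma cube_boundary_sub : cube_boundary R k `<=` cube R k.
Proof. by move=> t []. Qed.

Lemma spheroid_homotopic_refl z a : spheroid R k z a ->
  spheroid_homotopic z a a.
Proof.
move=> [ca az]; exists (a \o snd); split=> //=.
  apply: (within_comp (f := snd) ca); last by move=> x [].
  by apply: continuous_subspaceT; cont.
by move=> s t _ /az.
Qed.

Lemma spheroid_homotopic_sym z a b :
  spheroid_homotopic z a b -> spheroid_homotopic z b a.
Proof.
move=> [H [cH H0 H1 Hz]]; exists (fun x => H (1 - x.1, x.2)); split=> /=.
- exact: homotopy_reverse.
- by move=> t tc; rewrite subr0 H1.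
- by move=> t tc; rewrite subrr H0.
- by move=> s t s01 tb; rewrite Hz //; lra.
Qed.

Lemma spheroid_homotopic_trans z a b c : spheroid_homotopic z a b ->
  spheroid_homotopic z b c -> spheroid_homotopic z a c.
Proof.
move=> [H [cH H0 H1 Hz]] [K [cK K0 K1 Kz]].
have HK t : cube R k t -> H (1, t) = K (0, t) by move=> tc; rewrite H1 // K0.
exists (homotopy_concat H K); split.
- exact: homotopy_concat_continuous.
- by move=> t tc; rewrite homotopy_concatl ?mulr0 ?H0 //; lra.
- move=> t tc; rewrite (homotopy_concatr tc HK); last by lra.
  by rewrite -K1 //; congr (K (_, _)); lra.
- move=> s t s01 tb; have [s2|/ltW s2] := leP s 2^-1.
    by rewrite homotopy_concatl // Hz //; lra.
  by rewrite (homotopy_concatr (cube_boundary_sub tb) HK) // Kz //; lra.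
Qed.

Lemma spheroid_comp (W : topologicalType) (f : Z -> W) z a :
  continuous f -> spheroid R k z a -> spheroid R k (f z) (f \o a).
Proof.
by move=> cf [ca az]; split; [exact: within_compl|move=> t /az /= ->].
Qed.

Lemma spheroid_homotopic_comp (W : topologicalType) (f : Z -> W) z a b :
  continuous f -> spheroid_homotopic z a b ->
  spheroid_homotopic (f z) (f \o a) (f \o b).
Proof.
move=> cf [H [cH H0 H1 Hz]]; exists (f \o H); split=> /=.
- exact: within_compl.
- by move=> t /H0 ->.
- by move=> t /H1 ->.
- by move=> s t s01 /(Hz s t s01) ->.
Qed.

Lemma spheroid_class_eqP z a b : spheroid R k z a -> spheroid R k z b ->
  spheroid_class z a = spheroid_class z b <-> spheroid_homotopic z a b.
Proof.
move=> sa sb; split=> [ab|ab].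
  by have [_] : spheroid_class z a b by rewrite ab; split=> //;
    exact: spheroid_homotopic_refl.
apply/seteqP; split => c [sc h]; split=> //.
  by apply: spheroid_homotopic_trans h; exact: spheroid_homotopic_sym.
exact: spheroid_homotopic_trans h.
Qed.

End Spheroids.

Lemma homotopy_group_map_class (k : nat) (Z W : topologicalType) (f : Z -> W) z
    (a : 'rV[R]_k -> Z) :
  continuous f -> spheroid R k z a ->
  homotopy_group_map f z (spheroid_class z a) = spheroid_class (f z) (f \o a).
Proof.
move=> cf sa; apply/seteqP; split => [b [a' [sa' aa'] [sb a'b]]|b bfa].
  split=> //; apply: spheroid_homotopic_trans a'b.
  exact: spheroid_homotopic_comp.
by exists a => //; split=> //; exact: spheroid_homotopic_refl.
Qed.

Section Paths.
Context {Z : topologicalType}.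
Implicit Types z w : Z.

(** A path is viewed as a homotopy with an idle parameter, so that the concatenation of homotopies
    also serves for paths. *)
Let timeE (g : R -> Z) : {within `[0, 1], continuous g} <->
  {within [set` `[0 : R, 1]] `*` [set: R], continuous (g \o fst)}.
Proof.
split=> [cg|cg].
  apply: (within_comp (f := fst) cg); last by move=> x [].
  by apply: continuous_subspaceT; cont.
have := within_comp (f := fun s : R => (s, 0 : R)) (A := [set` `[0 : R, 1]]) cg.
apply; last by move=> s s01; split.
by apply: continuous_subspaceT; cont.
Qed.

Lemma path_component_refl z : path_component R z z.
Proof.
by exists (fun=> z); split=> //; apply: continuous_subspaceT; exact: cont_cst.
Qed.

Lemma path_component_sym z w : path_component R z w -> path_component R w z.
Proof.
move=> [g [cg g0 g1]]; exists (fun s => g (1 - s)).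
rewrite subr0 subrr; split=> //.
apply: (within_comp (f := fun s : R => 1 - s) cg).
  by apply: continuous_subspaceT; cont.
by move=> s; rewrite /= !in_itv /=; lra.
Qed.

Lemma path_component_trans z w x : path_component R z w ->
  path_component R w x -> path_component R z x.
Proof.
move=> [g [/timeE cg g0 g1]] [h [/timeE ch h0 h1]].
have gh (t : R) : [set: R] t -> (g \o fst) (1 : R, t) = (h \o fst) (0 : R, t).
  by rewrite /= g1 h0.
exists (fun s => homotopy_concat (g \o fst) (h \o fst) (s, 0 : R)); split.
- apply: (within_comp (f := fun s : R => (s, 0 : R))
      (homotopy_concat_continuous cg ch gh)); last by move=> s s01; split.
  by apply: continuous_subspaceT; cont.
- by rewrite homotopy_concatl ?mulr0 //=; lra.
- rewrite (homotopy_concatr (A := setT) _ gh) //=; last by lra.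
  by rewrite -h1; congr h; lra.
Qed.

Lemma path_component_eqP z w :
  path_component R z = path_component R w <-> path_component R z w.
Proof.
split=> [->|zw]; first exact: path_component_refl.
apply/seteqP; split => x; last exact: path_component_trans.
by apply: path_component_trans; exact: path_component_sym.
Qed.

End Paths.

Lemma pi0_map_component (Z W : topologicalType) (f : Z -> W) z :
  continuous f -> pi0_map R f (path_component R z) = path_component R (f z).
Proof.
move=> cf; apply/seteqP; split => [w [z' [g [cg g0 g1]] zw]|w zw].
  apply: path_component_trans zw; exists (f \o g) => /=; rewrite g0 g1.
  by split=> //; exact: within_compl.
by exists z => //; exact: path_component_refl.
Qed.

(** Classes are sets of representatives and the induced maps send the class of [a] to that of
    [f \o a]; bijectivity thus becomes two statements about representatives in each degree. *)
Lemma weak_homotopy_equivalenceP (Z W : topologicalType) (f : Z -> W) :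
  weak_homotopy_equivalence R f <->
  [/\ continuous f,
      forall z z', path_component R (f z) (f z') -> path_component R z z',
      forall w, exists z, path_component R (f z) w,
      forall k z (a b : 'rV[R]_k -> Z), (0 < k)%N ->
        spheroid R k z a -> spheroid R k z b ->
        spheroid_homotopic (f z) (f \o a) (f \o b) -> spheroid_homotopic z a b &
      forall k z (c : 'rV[R]_k -> W), (0 < k)%N -> spheroid R k (f z) c ->
        exists2 a, spheroid R k z a & spheroid_homotopic (f z) (f \o a) c].
Proof.
split=> [[cf [_ inj0 surj0] bijk]|[cf inj0 surj0 injk surjk]]; split=> //.
- move=> z z' zz'; apply/path_component_eqP.
  apply: inj0; rewrite ?inE; [by exists z|by exists z'|].
  by rewrite !pi0_map_component //; apply/path_component_eqP.
- move=> w; have [|c [z _ <-]] := surj0 (path_component R w); first by exists w.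
  by rewrite pi0_map_component // => /path_component_eqP ?; exists z.
- move=> k z a b k0 sa sb fab; have [_ injk _] := bijk k z k0.
  apply/(spheroid_class_eqP sa sb).
  apply: injk; rewrite ?inE; [by exists a|by exists b|].
  rewrite !homotopy_group_map_class //; apply/spheroid_class_eqP => //;
  exact: spheroid_comp.
- move=> k z c k0 sc; have [_ _ surjk] := bijk k z k0.
  have [|d [a sa <-]] := surjk (spheroid_class (f z) c); first by exists c.
  rewrite homotopy_group_map_class // => h; exists a => //.
  by apply/spheroid_class_eqP => //; exact: spheroid_comp.
- split.
  + by move=> _ [z _ <-]; rewrite pi0_map_component //; exists (f z).
  + move=> c d; rewrite !inE => -[z _ <-] [z' _ <-].
    rewrite !pi0_map_component // => /path_component_eqP /inj0 zz'.
    exact/path_component_eqP.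
  + move=> _ [w _ <-]; have [z zw] := surj0 w.
    exists (path_component R z); first by exists z.
    by rewrite pi0_map_component //; exact/path_component_eqP.
- move=> k z k0; split.
  + move=> _ [a sa <-]; rewrite homotopy_group_map_class //.
    by exists (f \o a) => //; exact: spheroid_comp.
  + move=> c d; rewrite !inE => -[a sa <-] [b sb <-].
    rewrite !homotopy_group_map_class // => h.
    apply/spheroid_class_eqP => //; apply: injk => //.
    by apply/spheroid_class_eqP => //; exact: spheroid_comp.
  + move=> _ [c sc <-]; have [a sa ac] := surjk k z c k0 sc.
    exists (spheroid_class z a); first by exists a.
    rewrite homotopy_group_map_class //; apply/spheroid_class_eqP => //.
    exact: spheroid_comp.
Qed.

End HomotopyRelations.

(** * The cube of dimension k + 1 with its first coordinate set apart as a time *)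

Section Prism.
Context {R : realType} (k : nat).

Definition prism : set (R * 'rV[R]_k) := [set` `[0 : R, 1]] `*` cube R k.

Definition prism_boundary : set (R * 'rV[R]_k) :=
  [set x | prism x /\ [\/ x.1 = 0, x.1 = 1 | cube_boundary R k x.2]].

Definition rV_cons (x : R * 'rV[R]_k) : 'rV[R]_k.+1 :=
  \row_i (if unlift ord0 i is Some j then x.2 ord0 j else x.1).

Definition rV_uncons (u : 'rV[R]_k.+1) : R * 'rV[R]_k :=
  (u ord0 ord0, \row_j u ord0 (lift ord0 j)).

Lemma rV_cons0 x : rV_cons x ord0 ord0 = x.1.
Proof. by rewrite mxE unlift_none. Qed.

Lemma rV_consS x j : rV_cons x ord0 (lift ord0 j) = x.2 ord0 j.
Proof. by rewrite mxE liftK. Qed.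

Lemma rV_consK : cancel rV_cons rV_uncons.
Proof.
move=> [s t]; rewrite /rV_uncons rV_cons0; congr pair.
by apply/rowP => j; rewrite mxE rV_consS.
Qed.

Lemma rV_unconsK : cancel rV_uncons rV_cons.
Proof.
move=> u; apply/rowP => i; case: (unliftP ord0 i) => [j|] ->.
  by rewrite rV_consS mxE.
by rewrite rV_cons0.
Qed.

Lemma rV_cons_continuous : continuous rV_cons.
Proof.
apply: continuous_row => i; case: unlift => [j|]; last by cont.
by apply: continuous_coord; cont.
Qed.

Lemma rV_uncons_continuous : continuous rV_uncons.
Proof.
apply: cont_pair; first exact: coord_continuous.
by apply: continuous_row => j; exact: coord_continuous.
Qed.

Lemma rV_cons_cube x : prism x -> cube R k.+1 (rV_cons x).
Proof.
move=> [/= x1 x2] i; rewrite in_itv /= in x1; case: (unliftP ord0 i) => [j|] ->.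
  by rewrite rV_consS.
by rewrite rV_cons0.
Qed.

Lemma rV_cons_boundary x : prism_boundary x -> cube_boundary R k.+1 (rV_cons x).
Proof.
move=> [px bx]; split; first exact: rV_cons_cube.
case: bx => [x0|x1|[_ [j xj]]]; last by exists (lift ord0 j); rewrite rV_consS.
- by exists ord0; rewrite rV_cons0; left.
- by exists ord0; rewrite rV_cons0; right.
Qed.

Lemma rV_uncons_prism u : cube R k.+1 u -> prism (rV_uncons u).
Proof.
move=> uc; split; first by rewrite /= in_itv /=; exact: uc.
by move=> j; rewrite mxE; exact: uc.
Qed.

Lemma rV_uncons_boundary u : cube_boundary R k.+1 u ->
  prism_boundary (rV_uncons u).
Proof.
move=> [uc [i ui]]; split; first exact: rV_uncons_prism.
case: (unliftP ord0 i) ui => [j|] -> ui; last first.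
  by case: ui => /= ->; [apply: Or31|apply: Or32].
apply: Or33; split; first by have [] := rV_uncons_prism uc.
by exists j; rewrite mxE.
Qed.

Lemma prism_boundary_sub : prism_boundary `<=` prism.
Proof. by move=> x []. Qed.

Lemma prism_lifting (Z W : topologicalType) (f : Z -> W) (O : set W) :
  rel_lifting R f O (cube R k.+1) (cube_boundary R k.+1) ->
  rel_lifting R f O prism prism_boundary.
Proof.
apply: (rel_lifting_retract rV_cons_continuous rV_uncons_continuous
  rV_cons_cube rV_cons_boundary rV_uncons_prism rV_uncons_boundary).
- by move=> x _; exact: rV_consK.
- exact: prism_boundary_sub.
Qed.

End Prism.

Arguments prism {R} k.
Arguments prism_boundary {R} k.

(** * Lifting properties imply weak equivalence *)

Section LiftingImpliesEquivalence.
Context {R : realType} {Z W : topologicalType} (f : Z -> W).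

(* A map [b] out of the empty boundary of a point exists only if [Z] is
   inhabited, so the case of an empty [Z] is not covered by [rel_lifting]. *)
Definition ball_liftings (O : set W) : Prop :=
  (O !=set0 -> inhabited Z) /\
  forall k, rel_lifting R f O (unit_ball 'rV[R]_k) (unit_sphere 'rV[R]_k).

(** Injectivity on path components is lifting for an interval and its ends, surjectivity is lifting
    for a point. On homotopy groups, injectivity is lifting for a prism and its boundary,
    surjectivity is lifting for a cube with constant boundary values. *)
Lemma ball_liftings_equivalence :
  continuous f -> ball_liftings setT -> weak_homotopy_equivalence R f.
Proof.
move=> cf [inh L].
have {}L k : rel_lifting R f setT (cube R k) (cube_boundary R k).
  by apply/cube_ball_retract.
have h0 : (0 <= 2^-1 :> R) = true by lra.
have h1 : (1 <= 2^-1 :> R) = false by apply/negbTE; rewrite -ltNge; lra.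
apply/weak_homotopy_equivalenceP; split=> //.
- move=> z z' [g [cg g0 g1]].
  (* Only the ends 0 and 1 matter; the threshold 1/2 merely separates them. *)
  pose b (t : 'rV[R]_1) := if t ord0 ord0 <= 2^-1 then z else z'.
  have bE t : cube_boundary R 1 t -> t ord0 ord0 = 0 \/ t ord0 ord0 = 1.
    by move=> [_ [i]]; have -> : i = ord0 by exact: ord1.
  have [||//||b' [H [cb' bb' _ _]]] := L 1%N (fun t => g (t ord0 ord0)) b.
  + apply: (within_comp (f := fun t : 'rV[R]_1 => t ord0 ord0) cg).
      by apply: continuous_subspaceT; exact: coord_continuous.
    by move=> t /(_ ord0); rewrite /= in_itv.
  + apply: (within_paste_le (u := fun t : 'rV[R]_1 => t ord0 ord0) (c := 2^-1)
      (f := fun=> z) (g := fun=> z')).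
    * exact: coord_continuous.
    * by move=> t _; rewrite /b => ->.
    * move=> t /bE + h; rewrite /b; case=> e; rewrite e in h *.
        by exfalso; lra.
      by rewrite h1.
    * by apply: continuous_subspaceT; exact: cont_cst.
    * by apply: continuous_subspaceT; exact: cont_cst.
  + move=> t /bE; rewrite /b; case=> ->; first by rewrite h0 g0.
    by rewrite h1 g1.
  have e (s : R) : (const_mx s : 'rV[R]_1) ord0 ord0 = s by rewrite mxE.
  exists (fun s => b' (const_mx s)); split.
  + apply: (within_comp (f := fun s : R => const_mx s) cb').
      apply: continuous_subspaceT.
      have -> : (fun s : R => const_mx s : 'rV[R]_1) = fun s => \row_(i < 1) s.
        by apply/funext => s; apply/rowP => i; rewrite !mxE.
      by apply: continuous_row => i; cont.
    by move=> s; rewrite /= in_itv => s01 i; rewrite mxE.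
  + rewrite bb'; first by rewrite /b e h0.
    split; last by exists ord0; rewrite e; left.
    by move=> i; rewrite mxE; lra.
  + rewrite bb'; first by rewrite /b e h1.
    split; last by exists ord0; rewrite e; right.
    by move=> i; rewrite mxE; lra.
- move=> w; have [|z0] := inh; first by exists w.
  (* The boundary of a point is empty, so any constant is an admissible boundary map; this is where
     a point of [Z] is required. *)
  have [||//||b' [H [_ _ [cH H0 H1 _] _]]] := L 0%N (fun=> w) (fun=> z0).
  + by apply: continuous_subspaceT; exact: cont_cst.
  + by apply: continuous_subspaceT; exact: cont_cst.
  + by move=> t [_ [[]]].
  have c0 : cube R 0 0 by case.
  exists (b' 0), (fun s => H (s, 0)); split.
  + apply: (within_comp (f := fun s : R => (s, 0 : 'rV[R]_0)) cH).
      by apply: continuous_subspaceT; cont.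
    by move=> s s01; split.
  + exact: H0.
  + exact: H1.
- move=> k z a b _ [ca az] [cb bz] [H [cH H0 H1 Hz]].
  (* On the boundary of the prism: [a] at the bottom, [b] at the top and [z] on the sides, where [a]
     and [b] agree. *)
  pose c (x : R * 'rV[R]_k) := if x.1 <= 2^-1 then a x.2 else b x.2.
  have cE (x : R * 'rV[R]_k) : cube_boundary R k x.2 -> c x = z.
    by rewrite /c; case: ifP => _; [exact: az|exact: bz].
  have c0 t : c (0, t) = a t by rewrite /c /= h0.
  have c1 t : c (1, t) = b t by rewrite /c /= h1.
  have [||//||b' [K [cb' bb' _ _]]] := prism_lifting (L k.+1) (a := H) (b := c).
  + exact: cH.
  + apply: (within_paste_le (u := fun x : R * 'rV[R]_k => x.1) (c := 2^-1)
      (f := fun x => a x.2) (g := fun x => b x.2)).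
    * by cont.
    * by move=> x _; rewrite /c => ->.
    * move=> [s t] [_ /= bx] s2; case: bx => [s0|s1|tb].
      - by rewrite s0 in s2; exfalso; lra.
      - by rewrite s1 c1.
      - by rewrite cE // bz.
    * apply: (within_comp (f := fun x : R * 'rV[R]_k => x.2) ca).
        by apply: continuous_subspaceT; cont.
      by move=> x [[[]]].
    * apply: (within_comp (f := fun x : R * 'rV[R]_k => x.2) cb).
        by apply: continuous_subspaceT; cont.
      by move=> x [[[]]].
  + move=> [s t] [[/= + tc] /= bx]; rewrite in_itv /= => s01.
    case: bx => [->|->|tb]; first by rewrite c0 H0.
      by rewrite c1 H1.
    by rewrite cE // Hz.
  exists b'; split=> //.
  + move=> t tc; rewrite bb' ?c0 //; split; last exact: Or31.
    by split=> //; rewrite /= in_itv /=; lra.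
  + move=> t tc; rewrite bb' ?c1 //; split; last exact: Or32.
    by split=> //; rewrite /= in_itv /=; lra.
  + move=> s t s01 tb; rewrite bb' ?cE //; split; last exact: Or33.
    by split; [rewrite /= in_itv|case: tb].
- move=> k z c _ [cc cz].
  have [|//|t tb|b' [H [cb' bb' [cH H0 H1 _] HB]]] := L k c (fun=> z) cc.
  + by apply: continuous_subspaceT; exact: cont_cst.
  + by rewrite cz.
  exists b'; first by split.
  by exists H; split=> // s t s01 tb; rewrite HB // cz.
Qed.

End LiftingImpliesEquivalence.

(** * Weak equivalence implies lifting properties *)

Section EquivalenceImpliesLifting.
Context {R : realType} {Z W : topologicalType} (f : Z -> W).
Hypothesis wf : weak_homotopy_equivalence R f.

Let cf : continuous f.
Proof. by have /weak_homotopy_equivalenceP [] := wf. Qed.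

(** In degree 0 a null homotopy is a path starting at [z], and injectivity on path components
    replaces injectivity on homotopy groups. *)
Lemma null_spheroid k (z : Z) (b : 'rV[R]_k -> Z) : spheroid R k z b ->
  spheroid_homotopic (f z) (f \o (fun=> z)) (f \o b) ->
  spheroid_homotopic z (fun=> z) b.
Proof.
have /weak_homotopy_equivalenceP [_ inj0 _ injk _] := wf.
move=> sb fb; have sz : spheroid R k z (fun=> z).
  by split=> //; apply: continuous_subspaceT; exact: cont_cst.
case: k b sb fb sz => [|k] b sb fb sz; last exact: injk fb.
have t0 (t : 'rV[R]_0) : t = 0 by apply/rowP => -[].
have c0 : cube R 0 0 by case.
have [|g [cg g0 g1]] := inj0 z (b 0).
  have [H [cH H0 H1 _]] := fb; exists (fun s => H (s, 0)); split.
  - apply: (within_comp (f := fun s : R => (s, 0 : 'rV[R]_0)) cH).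
      by apply: continuous_subspaceT; cont.
    by move=> s s01; split.
  - exact: H0.
  - exact: H1.
exists (g \o fst); split => /=.
- apply: (within_comp (f := fst) cg); last by move=> x [].
  by apply: continuous_subspaceT; cont.
- by move=> t _; rewrite g0.
- by move=> t _; rewrite g1 (t0 t).
- by move=> s t _ [_ [[]]].
Qed.

(** The time schedule of a detour: from 0 up to 2 at speed 4 during the first half, then back to 1
    at speed 2. *)
Let rate (s : R) : R := Num.min (4 * s) (3 - 2 * s).

Let rate_le s : s <= 2^-1 -> rate s = 4 * s.
Proof. by move=> ?; rewrite /rate min_l //; lra. Qed.

Let rate_ge s : 2^-1 <= s -> rate s = 3 - 2 * s.
Proof. by move=> ?; rewrite /rate min_r //; lra. Qed.

(* If [b] is constant outside the top face, it extends along a null homotopy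
   [G] of its restriction to this face; the difference between [a] and
   [f \o G] is a spheroid, which is corrected by a spheroid of [Z]. *)
Lemma top_face_lifting k (z : Z) (a : R * 'rV[R]_k -> W) (b : R * 'rV[R]_k ->
  Z) :
  {within prism k, continuous a} -> {within prism_boundary k, continuous b} ->
  (forall x, prism_boundary k x -> f (b x) = a x) ->
  (forall x, prism k x -> x.1 = 0 \/ cube_boundary R k x.2 -> b x = z) ->
  lifts_rel R f setT (prism k) (prism_boundary k) a b.
Proof.
move=> ca cb fb bz.
have in01 (s : R) : (s \in `[0, 1]) = (0 <= s <= 1) by rewrite in_itv.
have prismP (s : R) t : prism k (s, t) <-> 0 <= s <= 1 /\ cube R k t.
  by rewrite /prism /setX /= in01.
have bdP0 (t : 'rV[R]_k) : cube R k t -> prism_boundary k (0, t).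
  by move=> tc; split; [apply/prismP; split=> //; lra|exact: Or31].
have bdP1 (t : 'rV[R]_k) : cube R k t -> prism_boundary k (1, t).
  by move=> tc; split; [apply/prismP; split=> //; lra|exact: Or32].
have bdP (s : R) (t : 'rV[R]_k) : 0 <= s <= 1 -> cube_boundary R k t ->
    prism_boundary k (s, t).
  move=> s01 tb; split; last exact: Or33.
  by apply/prismP; split=> //; exact: cube_boundary_sub.
have b0 (t : 'rV[R]_k) : cube R k t -> b (0, t) = z.
  by move=> tc; apply: bz; [exact: (bdP0 t tc).1|left].
have bb (s : R) (t : 'rV[R]_k) : 0 <= s <= 1 -> cube_boundary R k t -> b (s,
  t) = z.
  by move=> s01 tb; apply: bz; [exact: (bdP s t s01 tb).1|right].
have a0 (t : 'rV[R]_k) : cube R k t -> a (0, t) = f z.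
  by move=> tc; rewrite -fb ?b0 //; exact: bdP0.
have ab (s : R) (t : 'rV[R]_k) : 0 <= s <= 1 -> cube_boundary R k t ->
    a (s, t) = f z.
  by move=> s01 tb; rewrite -fb ?bb //; exact: bdP.
have [||G [cG G0 G1 Gz]] := @null_spheroid k z (fun t => b (1, t)).
- split; last by move=> t tb; rewrite bb //; lra.
  apply: (within_comp (f := fun t : 'rV[R]_k => (1 : R, t)) cb) => //.
  by apply: continuous_subspaceT; cont.
- exists a; split=> //.
  by move=> t tc; rewrite -fb //; exact: bdP1.
(* [a] followed by [f \o G] backwards, on times 0 to 2; both ends and the sides are at [f z], so
   rescaling gives a spheroid, the difference between [a] and [f \o G]. *)
pose L (x : R * 'rV[R]_k) := if x.1 <= 1 then a x else f (G (2 - x.1, x.2)).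
have L1 (s : R) (t : 'rV[R]_k) : s <= 1 -> L (s, t) = a (s, t).
  by rewrite /L /= => ->.
have L2 (s : R) (t : 'rV[R]_k) : cube R k t -> 1 <= s ->
    L (s, t) = f (G (2 - s, t)).
  move=> tc s1; rewrite /L /=; case: ifPn => // s1'.
  have -> : s = 1 by apply/le_anti/andP.
  rewrite (_ : 2 - 1 = 1); last by lra.
  by rewrite -fb; [rewrite G1|exact: bdP1].
have cL : {within [set x : R * 'rV[R]_k | 0 <= x.1 <= 2 /\ cube R k x.2],
    continuous L}.
  apply: (within_paste_le (u := fun x : R * 'rV[R]_k => x.1) (c := 1)
    (f := a) (g := fun x : R * 'rV[R]_k => f (G (2 - x.1, x.2)))).
  - by cont.
  - by move=> [s t] _; exact: L1.
  - by move=> [s t] [/= _ tc]; exact: L2.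
  - apply: continuous_subspaceW ca => -[s t] [[/= s02 tc] s1].
    by apply/prismP; split=> //; move: s1 => /=; lra.
  - apply: (within_compl cf).
    apply: (within_comp (f := fun x : R * 'rV[R]_k => (2 - x.1, x.2)) cG).
      by apply: continuous_subspaceT; cont.
    by move=> [s t] [[/= s02 tc] s1]; split=> //=; rewrite in01; move: s1 =>
      /=; lra.
have Lz (s : R) (t : 'rV[R]_k) : 0 <= s <= 2 -> cube_boundary R k t ->
    L (s, t) = f z.
  move=> s02 tb; have [s1|/ltW s1] := leP s 1; first by rewrite L1 // ab //;
    lra.
  by rewrite L2 ?Gz //; [lra|exact: cube_boundary_sub].
pose d (u : 'rV[R]_k.+1) := let x := rV_uncons u in L (2 * x.1, x.2).
have sd : spheroid R k.+1 (f z) d.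
  split.
    apply: (within_comp (f := fun u : 'rV[R]_k.+1 =>
      (2 * (rV_uncons u).1, (rV_uncons u).2)) cL).
      apply: continuous_subspaceT; cont; exact: rV_uncons_continuous.
    move=> u /rV_uncons_prism; case: (rV_uncons u) => s t /prismP [s01 tc] /=.
    by split=> //; lra.
  move=> u /rV_uncons_boundary; rewrite /d; case: (rV_uncons u) => s t.
  case=> /prismP [s01 tc] /= [->|->|tb].
  - by rewrite mulr0 L1 ?a0 //; lra.
  - rewrite L2 //; last by lra.
    by rewrite mulr1 subrr G0.
  - by rewrite Lz //; lra.
have /weak_homotopy_equivalenceP [_ _ _ _ surjk] := wf.
have [//|e [ce ez] [M [cM M0 M1 Mz]]] := surjk k.+1 z d _ sd.
pose K (x : R * 'rV[R]_k) := e (rV_cons x).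
have cK : {within prism k, continuous K}.
  apply: (within_comp ce); last by move=> x; exact: rV_cons_cube.
  by apply: continuous_subspaceT; exact: rV_cons_continuous.
have KG t : cube R k t -> K (1, t) = G (0, t).
  by move=> tc; rewrite G0 // /K ez //; apply: rV_cons_boundary; exact: bdP1.
(* The image of [K] is homotopic to the difference spheroid, so following it by [f \o G] gives [a]
   with a detour that goes along [f \o G] backwards and returns. *)
pose b' := homotopy_concat K G.
have cb' : {within prism k, continuous b'} by exact: homotopy_concat_continuous.
have b'z t : cube R k t -> b' (0, t) = z.
  move=> tc; rewrite /b' homotopy_concatl ?mulr0; last by lra.
  by rewrite /K ez //; apply: rV_cons_boundary; exact: bdP0.
pose N (x : R * (R * 'rV[R]_k)) :=
  if x.2.1 <= 2^-1 then M (2 * x.1, rV_cons (2 * x.2.1, x.2.2))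
  else f (G (2 * x.2.1 - 1, x.2.2)).
(* After [M] has turned the image of [K] into the difference spheroid, the detour is contracted: the
   time moves linearly from [rate s] to [s], with [s = 0] and [s = 1] fixed. *)
pose v (x : R * (R * 'rV[R]_k)) : R :=
  (2 - 2 * x.1) * rate x.2.1 + (2 * x.1 - 1) * x.2.1.
have rate02 (s : R) : 0 <= s <= 1 -> 0 <= rate s <= 2.
  move=> s01; have [s2|/ltW s2] := leP s 2^-1; first by rewrite rate_le //; lra.
  by rewrite rate_ge //; lra.
have v02 (r s : R) t : 2^-1 <= r <= 1 -> 0 <= s <= 1 -> 0 <= v (r, (s, t)) <= 2.
  move=> r1 s01; have r02 := rate02 s s01; rewrite /v /=.
  by move: (rate s) r02 => q q02; nra.
have N1 (r s : R) (t : 'rV[R]_k) : s <= 2^-1 ->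
    N (r, (s, t)) = M (2 * r, rV_cons (2 * s, t)) by rewrite /N /= => ->.
have N2 (r s : R) (t : 'rV[R]_k) : 0 <= r <= 2^-1 -> cube R k t -> 2^-1 <= s ->
    N (r, (s, t)) = f (G (2 * s - 1, t)).
  move=> r2 tc s1; rewrite /N /=; case: ifPn => // s1'.
  have -> : s = 2^-1 by apply/le_anti/andP.
  rewrite (_ : 2 / 2 = 1); last by lra.
  rewrite Mz ?subrr ?G0 //; first by lra.
  by apply: rV_cons_boundary; exact: bdP1.
pose H (x : R * (R * 'rV[R]_k)) := if x.1 <= 2^-1 then N x else L (v x, x.2.2).
have H1 (r : R) x : r <= 2^-1 -> H (r, x) = N (r, x) by rewrite /H /= => ->.
have H2 (r s : R) t : 2^-1 <= r -> 0 <= s <= 1 -> cube R k t ->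
    H (r, (s, t)) = L (v (r, (s, t)), t).
  move=> r2 s01 tc; rewrite /H /=; case: ifPn => // r2'.
  have -> : r = 2^-1 by apply/le_anti/andP.
  have vE : v (2^-1, (s, t)) = rate s by rewrite /v /=; lra.
  have [s2|/ltW s2] := leP s 2^-1.
    rewrite N1 // (_ : 2 / 2 = 1); last by lra.
    rewrite M1; last by apply: rV_cons_cube; apply/prismP; split=> //; lra.
    rewrite /d rV_consK /= vE rate_le //; congr (L (_, _)); lra.
  rewrite N2 //; last by lra.
  rewrite vE rate_ge // L2 //; last by lra.
  by congr (f (G (_, _))); lra.
exists b', H; split.
- exact: cb'.
- move=> [s t] [/prismP [s01 tc]] /= [->|->|tb].
  + by rewrite b'z // b0.
  + rewrite /b' (homotopy_concatr tc KG); last by lra.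
    by rewrite -G1 //; congr (G (_, _)); lra.
  + have tc' := cube_boundary_sub tb; rewrite bb // /b'.
    have [s2|/ltW s2] := leP s 2^-1.
      rewrite homotopy_concatl // /K ez //; apply: rV_cons_boundary.
      by apply: bdP => //; lra.
    by rewrite (homotopy_concatr tc KG) // Gz //; lra.
- split=> //.
  + apply: (within_paste_le (u := fun x : R * (R * 'rV[R]_k) => x.1) (c := 2^-1)
      (f := N) (g := fun x => L (v x, x.2.2))).
    * by cont.
    * by move=> [r x] _; exact: H1.
    * move=> [r [s t]] [/= _ /prismP [s01 tc]] r2; exact: H2.
    * apply: (within_paste_le (u := fun x : R * (R * 'rV[R]_k) => x.2.1) (c :=
      2^-1)
        (f := fun x => M (2 * x.1, rV_cons (2 * x.2.1, x.2.2)))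
        (g := fun x => f (G (2 * x.2.1 - 1, x.2.2)))).
      - by cont.
      - by move=> [r [s t]] _; exact: N1.
      - move=> [r [s t]] [[/= + /prismP [s01 tc]] /= r2] s2; rewrite in01 =>
        r01.
        by apply: N2 => //; lra.
      - apply: (within_comp (f := fun x : R * (R * 'rV[R]_k) =>
          (2 * x.1, rV_cons (2 * x.2.1, x.2.2))) cM).
          apply: continuous_subspaceT; cont.
          apply: (cont_comp (f := fun x : R * (R * 'rV[R]_k) => (2 * x.2.1,
            x.2.2))
            (@rV_cons_continuous _ _)).
          by cont.
        move=> [r [s t]] [[[/= + /prismP [s01 tc]] /= r2] /= s2].
        rewrite in01 => r01; split; first by rewrite /= in01; lra.
        by apply: rV_cons_cube; apply/prismP; split=> //; lra.
      - apply: (within_compl cf).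
        apply: (within_comp (f := fun x : R * (R * 'rV[R]_k) =>
          (2 * x.2.1 - 1, x.2.2)) cG).
          by apply: continuous_subspaceT; cont.
        move=> [r [s t]] [[[/= _ /prismP [s01 tc]] /= r2] /= s2].
        by split=> //=; rewrite in01; lra.
    * apply: (within_comp (f := fun x => (v x, x.2.2)) cL).
        by apply: continuous_subspaceT; rewrite /v /rate; cont.
      move=> [r [s t]] [[/= + /prismP [s01 tc]] /= r2]; rewrite in01 => r01.
      by split=> //=; apply: v02 => //; lra.
  + move=> [s t] /prismP [s01 tc]; rewrite H1; last by lra.
    rewrite /b' /=; have [s2|/ltW s2] := leP s 2^-1.
      rewrite N1 // mulr0 M0 ?homotopy_concatl //.
      by apply: rV_cons_cube; apply/prismP; split=> //; lra.
    by rewrite N2 ?(homotopy_concatr tc KG) //; lra.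
  + move=> [s t] /prismP [s01 tc]; rewrite H2 //; last by lra.
    rewrite (_ : v _ = s) ?L1 //; last by rewrite /v /=; lra.
    by move: s01; lra.
- move=> r [s t] r01 [/prismP [s01 tc] /=] bx.
  have [r2|/ltW r2] := leP r 2^-1; last first.
    rewrite H2 //; case: bx => [->|->|tb].
    + have -> : v (r, (0, t)) = 0 by rewrite /v /= rate_le; lra.
      by rewrite L1 //; lra.
    + have -> : v (r, (1, t)) = 1 by rewrite /v /= rate_ge; lra.
      by rewrite L1.
    + by rewrite Lz ?ab //; apply: v02 => //; lra.
  rewrite H1 //; case: bx => [->|->|tb].
  + rewrite N1 ?mulr0; last by lra.
    rewrite Mz ?a0 //; first by lra.
    by apply: rV_cons_boundary; exact: bdP0.
  + rewrite N2 //; [|by lra|by lra].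
    rewrite (_ : 2 * 1 - 1 = 1); last by lra.
    by rewrite G1 // fb //; exact: bdP1.
  + rewrite ab //; have [s2|/ltW s2] := leP s 2^-1.
      rewrite N1 // Mz //; first by lra.
      by apply: rV_cons_boundary; apply: bdP => //; lra.
    by rewrite N2 // ?Gz //; lra.
Qed.

End EquivalenceImpliesLifting.

(** * Collapsing the sphere onto its top face *)

Section CollapseSphere.
Context {R : realType} (k : nat).
Local Notation V := (R * 'rV[R]_k)%type.
Implicit Types (s : R) (t : V).

Lemma prod_rV_norm t : `|t : V| = Num.max `|t.1| `|t.2|.
Proof. by []. Qed.

Lemma prod_ballE t : unit_ball V t <-> `|t.1| <= 1 /\ `|t.2| <= 1.
Proof. by rewrite /unit_ball /= prod_rV_norm ge_max; split =>
  [/andP|/andP]. Qed.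

Lemma prod_sphereE t : unit_sphere V t ->
  [/\ `|t.1| <= 1, `|t.2| <= 1 & `|t.1| = 1 \/ `|t.2| = 1].
Proof.
move=> t1; have [h1 h2] := iffLR (prod_ballE t) (unit_sphere_ball t1).
split=> //; move: t1; rewrite /unit_sphere /= prod_rV_norm.
by case: leP => _ ->; [right|left].
Qed.

(* After normalization, a deformation of the identity of the sphere to a map
   sending all of the sphere but the open top face to the center of the
   bottom face. *)
Definition collapse (x : R * V) : V :=
  ((1 - x.1) * x.2.1 + x.1 * Num.min x.2.1 (1 - 2 * `|x.2.2|),
   (1 - x.1 + x.1 * ((1 - `|x.2.2|) * (1 + x.2.1))) *: x.2.2).

Lemma collapse_continuous : continuous collapse.
Proof. by rewrite /collapse; cont. Qed.

Lemma collapse0 t : collapse (0, t) = t.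
Proof.
by case: t => y x; rewrite /collapse /= subr0 mul1r !mul0r !addr0 scale1r.
Qed.

Lemma collapse1 t : unit_ball V t -> t.1 = -1 \/ `|t.2| = 1 ->
  collapse (1, t) = (-1, 0).
Proof.
move=> /prod_ballE [y1 x1] yx; rewrite /collapse /= subrr !mul0r !add0r !mul1r.
rewrite ler_norml in y1; congr pair.
  by case: yx => ->; [rewrite min_l //|rewrite min_r]; lra.
by case: yx => ->; rewrite ?subrr ?mulr0 ?mul0r scale0r.
Qed.

(** The second component vanishes only where [t.2] is 0, and there the first is [t.1], of absolute
    value 1, or at time 1 on the bottom and the sides, and there the first is -1. Normalization is
    thus possible throughout. *)
Lemma collapse_neq0 s t : 0 <= s <= 1 -> unit_sphere V t -> collapse (s,
  t) != 0.
Proof.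
move=> s01 tS; apply/eqP => -[].
have [y1 x1 yx] := prod_sphereE tS; rewrite ler_norml in y1.
have [x0|x0] := eqVneq t.2 0.
  rewrite x0 normr0 mulr0 subr0 min_l; last by lra.
  rewrite -mulrDl subrK mul1r => y0 _; move: yx.
  by rewrite y0 x0 !normr0; case=> e; lra.
move=> e1 /eqP; rewrite scaler_eq0 (negbTE x0) orbF => /eqP e2.
have h1 : 0 <= s * ((1 - `|t.2|) * (1 + t.1)).
  by apply: mulr_ge0; [lra|apply: mulr_ge0; lra].
have se : s = 1 by lra.
move: e1 e2; rewrite se !mul1r subrr mul0r !add0r => e1 /eqP.
rewrite mulf_eq0 => /orP[/eqP e2|/eqP e2].
  by move: e1; rewrite min_r; lra.
by move: e1; rewrite min_l; have := normr_ge0 t.2; lra.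
Qed.

End CollapseSphere.

Section EquivalenceLifting.
Context {R : realType} {Z W : topologicalType} (f : Z -> W).
Hypothesis wf : weak_homotopy_equivalence R f.

Let cf : continuous f.
Proof. by have /weak_homotopy_equivalenceP [] := wf. Qed.

Lemma lifts_rel_eq (T : topologicalType) (O : set W) (A B : set T)
    (a : T -> W) (b c : T -> Z) : (forall t, B t -> b t = c t) ->
  lifts_rel R f O A B a b -> lifts_rel R f O A B a c.
Proof.
by move=> bc [b' [H [? h ? ?]]]; exists b', H; split=> // t Bt; rewrite h ?bc.
Qed.

Local Notation V k := (R * 'rV[R]_k)%type.

(** The normalized collapse deforms [b] to a map constant outside the top face, and solvability is
    invariant under such a deformation. In the maximum norm the ball is affinely a prism, which
    leaves the case of a single nonconstant face. *)
Lemma prod_ball_lifting k :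
  rel_lifting R f setT (unit_ball (V k))
    (unit_sphere (V k)).
Proof.
move=> a b ca cb _ fb.
pose n (v : V k) : V k := `|v|^-1 *: v.
pose bs (x : R * V k) := b (n (collapse x)).
have nS v : v != 0 -> unit_sphere (V k) (n v).
  move=> v0; rewrite /unit_sphere /n /= normrZ normfV normr_id mulVf //.
  by rewrite normr_eq0.
have cn v : v != 0 -> {for v, continuous n}.
  move=> v0; apply: cvgZ; last exact: cvg_id.
  by apply: cvgV; [rewrite normr_eq0|apply: cvg_norm; exact: cvg_id].
have cbs : {within [set` `[0 : R, 1]] `*` unit_sphere (V k), continuous bs}.
  apply: (within_comp (f := fun x : R * V k => n (collapse x)) cb).
    apply: within_continuous_comp.
      move=> v /set_mem [[s t] [/= + tS] <-]; rewrite in_itv /= => s01.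
      by apply: cn; exact: collapse_neq0.
    by apply: continuous_subspaceT; exact: collapse_continuous.
  move=> [s t] [/= + tS]; rewrite in_itv /= => s01.
  by apply: nS; exact: collapse_neq0.
have bs0 t : unit_sphere (V k) t -> bs (0, t) = b t.
  by rewrite /bs collapse0 /n => ->; rewrite invr1 scale1r.
apply: (lifts_rel_eq bs0); apply: (rel_lifting_deform cf cbs) => //; last first.
  by move=> t tS; rewrite bs0 // fb.
move=> {ca fb a bs0} a ca _ fb.
pose p (t : V k) : V k := ((t.1 + 1) / 2, \row_i ((t.2 ord0 i + 1) / 2)).
pose q (t : V k) : V k := (2 * t.1 - 1, \row_i (2 * t.2 ord0 i - 1)).
have cp : continuous p.
  apply: cont_pair; first by cont.
  apply: continuous_row => i; cont.
  by apply: continuous_coord; cont.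
have cq : continuous q.
  apply: cont_pair; first by cont.
  apply: continuous_row => i; cont.
  by apply: continuous_coord; cont.
have pA t : unit_ball (V k) t -> prism k (p t).
  move=> /prod_ballE [y1 /(rV_norm_leP _ ler01) x1]; rewrite ler_norml in y1.
  split; first by rewrite /= in_itv /=; lra.
  by move=> i; rewrite mxE; have := x1 i; rewrite ler_norml; lra.
have pB t : unit_sphere (V k) t -> prism_boundary k (p t).
  move=> tS; split; first exact/pA/unit_sphere_ball.
  have [y1 x1 yx] := prod_sphereE tS.
  case: yx => [y|/rV_norm_eq1P [_ [i xi]]].
    have [y0|y0] := lerP 0 t.1.
      by rewrite ger0_norm // in y; rewrite /p y; apply: Or32 => /=; lra.
    by rewrite ltr0_norm // in y; apply: Or31; rewrite /p /=; lra.
  apply: Or33; split; first by have [] := pA t (unit_sphere_ball tS).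
  exists i; rewrite mxE; have [y0|y0] := lerP 0 (t.2 ord0 i).
    by right; rewrite ger0_norm // in xi; rewrite xi; lra.
  by left; rewrite ltr0_norm // in xi; lra.
have qA t : prism k t -> unit_ball (V k) (q t).
  move=> [/= + tc]; rewrite in_itv /= => s01; apply/prod_ballE; split.
    by rewrite ler_norml /=; lra.
  apply/(rV_norm_leP _ ler01) => i; rewrite mxE ler_norml.
  by have := tc i; lra.
have q2 t : prism k t -> cube_boundary R k t.2 -> `|(q t).2| = 1.
  move=> tp [_ [i ti]]; apply/rV_norm_eq1P; split.
    by have /prod_ballE [] := qA t tp.
  exists i; rewrite mxE; case: ti => ->; first by rewrite mulr0 sub0r normrN1.
  by rewrite (_ : _ - 1 = 1) ?normr1; lra.
have q1 t : t.1 = 0 -> (q t).1 = -1 by rewrite /q /= => ->; lra.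
have qB t : prism_boundary k t -> unit_sphere (V k) (q t).
  move=> [tp bt]; have /prod_ballE [h1 h2] := qA t tp.
  rewrite /unit_sphere /= prod_rV_norm; case: bt => [t1|t1|t2].
  - by rewrite q1 // normrN1 max_l // -(normr1 R).
  - by rewrite /q /= t1 (_ : 2 * 1 - 1 = 1) ?normr1 ?max_l //; lra.
  - by rewrite (q2 t) // max_r.
apply: (lifts_rel_retract (q := q) cp pA pB).
- move=> [y x] _; rewrite /q /p /=; congr pair; first by lra.
  by apply/rowP => i; rewrite !mxE; lra.
- exact: unit_sphere_ball.
apply: (top_face_lifting wf (z := b (-1, 0))).
- by apply: (within_comp ca) => //; exact: continuous_subspaceT.
- apply: (within_comp (f := fun t : V k => (1 : R, q t)) cbs).
    by apply: continuous_subspaceT; cont.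
  by move=> t /qB tS; split=> //; rewrite /= in_itv /=; lra.
- by move=> t /qB tS; exact: fb.
- move=> t tp h; rewrite /= /bs collapse1; last 2 first.
  + exact: qA.
  + by case: h => [/q1|/(q2 t tp)]; [left|right].
  by rewrite /n prod_rV_norm /= normrN1 normr0 max_l // invr1 scale1r.
Qed.

Lemma equivalence_ball_liftings : ball_liftings (R := R) f setT.
Proof.
have /weak_homotopy_equivalenceP [_ _ surj0 _ _] := wf.
split; first by move=> [w _]; have [z _] := surj0 w.
case=> [|k].
  move=> a b ca cb _ fb; have [z [g [cg g0 g1]]] := surj0 (a 0).
  have t0 (t : 'rV[R]_0) : t = 0 by apply/rowP => -[].
  have nS t : ~ unit_sphere 'rV[R]_0 t.
    by rewrite (t0 t) /unit_sphere /= normr0 => /esym/eqP; rewrite oner_eq0.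
  exists (fun=> z), (g \o fst); split=> //.
  - by apply: continuous_subspaceT; exact: cont_cst.
  - by move=> t /nS.
  - split=> //=.
    + apply: (within_comp (f := fst) cg); last by move=> x [].
      by apply: continuous_subspaceT; cont.
    + by move=> t _; rewrite g1 (t0 t).
  - by move=> s t _ /nS.
apply: (rel_lifting_retract (@rV_uncons_continuous R k) (@rV_cons_continuous R
  k))
  (@prod_ball_lifting k).
- move=> u /(rV_norm_leP _ ler01) u1; apply/prod_ballE.
  split; first exact: u1.
  by apply/(rV_norm_leP _ ler01) => i; rewrite mxE.
- move=> u uS; have [u1 [i ui]] := iffLR (rV_norm_eq1P _) uS.
  have v1 : unit_ball (V k) (rV_uncons u).
    apply/prod_ballE; split; first exact: (iffLR (rV_norm_leP _ ler01) u1).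
    apply/(rV_norm_leP _ ler01) => j; rewrite mxE.
    exact: (iffLR (rV_norm_leP _ ler01) u1).
  have /prod_ballE [h1 h2] := v1.
  rewrite /unit_sphere /= prod_rV_norm; move: ui.
  case: (unliftP ord0 i) => [j|] -> ui.
    rewrite (_ : `|(rV_uncons u).2| = 1) ?max_r //.
    by apply/rV_norm_eq1P; split=> //; exists j; rewrite mxE.
  by rewrite max_l /= ui.
- move=> x /prod_ballE [x1 /(rV_norm_leP _ ler01) x2].
  apply/(rV_norm_leP _ ler01) => i; case: (unliftP ord0 i) => [j|] ->.
    by rewrite rV_consS.
  by rewrite rV_cons0.
- move=> x /prod_sphereE [x1 x2 x12]; apply/rV_norm_eq1P; split.
    apply/(rV_norm_leP _ ler01) => i; case: (unliftP ord0 i) => [j|] ->.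
      by rewrite rV_consS; exact: (iffLR (rV_norm_leP _ ler01) x2).
    by rewrite rV_cons0.
  case: x12 => [?|/rV_norm_eq1P [_ [j ?]]]; first by exists ord0;
    rewrite rV_cons0.
  by exists (lift ord0 j); rewrite rV_consS.
- by move=> u _; exact: rV_unconsK.
- exact: unit_sphere_ball.
Qed.

End EquivalenceLifting.

(** * A model of homotopy colimits *)

Section Total.
Context {d : Order.disp_t} {P : porderType d} (F : op_diagram P).

(* A model of the homotopy colimit of [F]: the points of [F p] specialize
   those of [F q] for [p <= q], as in the theory of finite spaces. *)
Definition total : Type := {p : P & F p}.

Definition total_open (W : set total) : Prop :=
  (forall p, open [set x : F p | W (existT _ p x)]) /\
  forall p q (pq : (p <= q)%O) (y : F q),
    W (existT _ p (diag_map F pq y)) -> W (existT _ q y).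

Lemma total_openT : total_open setT.
Proof. by split=> // p; exact: openT. Qed.

Lemma total_openI : setI_closed total_open.
Proof.
move=> U V [oU uU] [oV uV]; split; first by move=> p; exact: openI.
by move=> p q pq y [Uy Vy]; split; [exact: uU Uy|exact: uV Vy].
Qed.

Lemma total_open_bigU (I : Type) (f : I -> set total) :
  (forall i, total_open (f i)) -> total_open (\bigcup_i f i).
Proof.
move=> fo; split=> [p|p q pq y [i _ fy]]; last first.
  by exists i => //; exact: (fo i).2 fy.
rewrite (_ : [set x | _] = \bigcup_i [set x : F p | f i (existT _ p x)]) //.
by apply: bigcup_open => i _; exact: (fo i).1.
Qed.

HB.instance Definition _ := gen_eqMixin total.
HB.instance Definition _ := gen_choiceMixin total.
HB.instance Definition _ := isOpenTopological.Build total
  total_openT total_openI total_open_bigU.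

Implicit Types (p q : P) (h : total).

Definition tot p (x : F p) : total := existT _ p x.
Definition idx h : P := projT1 h.
Definition pt h : F (idx h) := projT2 h.

Lemma total_openE (W : set total) : open W = total_open W.
Proof. by []. Qed.

(** For [V] open, the smallest open set containing the points of [V] in [F p]; these sets form a
    neighbourhood basis at each point of [F p]. *)
Definition basic p (V : set (F p)) : set total :=
  [set h | exists pq : (p <= idx h)%O, V (diag_map F pq (pt h))].

Lemma basic_open p (V : set (F p)) : open V -> open (basic V).
Proof.
move=> oV; rewrite total_openE; split.
  move=> q; have [pq|pq] := boolP (p <= q)%O; last first.
    rewrite (_ : [set x | _] = set0); first exact: open0.
    by apply/seteqP; split=> // x [pq']; rewrite pq' in pq.
  rewrite (_ : [set x | _] = diag_map F pq @^-1` V).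
    by apply: open_comp => // x _; exact: cts_fun.
  apply/seteqP; split => x /=; last by exists pq.
  by move=> [pq' Vx]; rewrite (bool_irrelevance pq pq').
move=> q r qr y [pq Vy]; exists (le_trans pq qr).
by rewrite -(diag_map_comp pq qr).
Qed.

Definition above p : set total := [set h | (p <= idx h)%O].

Lemma above_open p : open (above p).
Proof.
have -> : above p = basic (setT : set (F p)).
  by apply/seteqP; split => [h ph|h []//]; exists ph.
exact: basic_open openT.
Qed.

Lemma total_within_continuousP (T : topologicalType) (A : set T) (K : T ->
  total) :
  {within A, continuous K} <->
  forall t, A t -> forall V, open V -> V (pt (K t)) ->
    \forall t' \near t, A t' -> basic V (K t').
Proof.
split=> [/within_continuousP cK t At V oV VK|cK].
  apply: cK => //; apply: open_nbhs_nbhs; split; first exact: basic_open.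
  by exists (lexx _); rewrite diag_map_id.
apply/within_continuousP => t At N /nbhs_interior /nbhs_singleton NK.
have [oN uN] : total_open (N°) by rewrite -total_openE; exact: open_interior.
pose V := [set x : F (idx (K t)) | N° (tot x)].
have VK : V (pt (K t)) by rewrite /V /tot /pt /=; case: (K t) NK.
have := cK t At V (oN _) VK; apply: filterS => t' h /h [pq Vt'].
by apply: interior_subset; move: pq Vt'; rewrite /V; case: (K t') => q y /= pq;
  exact: uN.
Qed.

(** The points of index at least that of [K t] form an open set: near [t] the index can only
    rise. *)
Lemma idx_near (T : topologicalType) (A : set T) (K : T -> total) t :
  {within A, continuous K} -> A t ->
  \forall t' \near t, A t' -> (idx (K t) <= idx (K t'))%O.
Proof.
move=> /total_within_continuousP cK At.
have := cK t At setT openT I.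
by apply: filterS => t' h /h [].
Qed.

(* The value [y0] is used only outside of [above p]. *)
Definition total_proj p (y0 : F p) h : F p :=
  if pselect (p <= idx h)%O is left pq then diag_map F pq (pt h) else y0.

Lemma total_projE p (y0 : F p) h (pq : (p <= idx h)%O) :
  total_proj y0 h = diag_map F pq (pt h).
Proof.
by rewrite /total_proj; case: pselect => [pq'|//];
  rewrite (bool_irrelevance pq pq').
Qed.

Lemma total_proj_continuous p (y0 : F p) : {within above p,
  continuous (total_proj y0)}.
Proof.
apply/within_continuousP => h ph V /nbhs_interior /nbhs_singleton Vh.
have : nbhs h (basic (V°)).
  apply: open_nbhs_nbhs; split; first by apply: basic_open;
    exact: open_interior.
  by exists ph; rewrite -(total_projE y0).
by apply: filterS => h' [pq' Vh'] _; rewrite (total_projE _ pq');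
  exact: interior_subset.
Qed.

(** The jump across the frontier of [M] is continuous because a basic neighbourhood of [tot (y t)]
    contains every point above [p] whose image in [F p] is close to [y t]; off the closed set [M]
    only [g] matters. *)
Lemma total_glue (T : topologicalType) (A M : set T) p (y : T -> F p)
    (g : T -> total) :
  closed M -> {within A, continuous y} -> {within A `\` M, continuous g} ->
  (forall t, A t -> ~ M t -> exists pq : (p <= idx (g t))%O,
    diag_map F pq (pt (g t)) = y t) ->
  {within A, continuous (fun t => if `[< M t >] then tot (y t) else g t)}.
Proof.
move=> cM /within_continuousP cy /total_within_continuousP cg yg.
apply/total_within_continuousP => t At V; case: asboolP V => [Mt|Mt] V oV Vt.
  have := cy t At V (open_nbhs_nbhs (conj oV Vt)).
  apply: filterS => t' h At'; have {}h := h At'; case: asboolP => [Mt'|Mt'].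
    by exists (lexx p); rewrite diag_map_id.
  by have [pq e] := yg t' At' Mt'; exists pq; rewrite e.
have nM : \forall t' \near t, ~ M t'.
  by apply: open_nbhs_nbhs; split=> //; exact: closed_openC.
have := cg t (conj At Mt) V oV Vt.
apply: filterS2 nM => t' nM h At'; case: asboolP => [//|_].
by apply: h; split.
Qed.

End Total.

Arguments above {d P F} p.

Section TotalMap.
Context {d : Order.disp_t} {P : porderType d}.

Definition total_map (D E : op_diagram P) (phi : nat_trans D E) (h : total D) :
  total E := tot (phi (idx h) (pt h)).

Lemma total_map_continuous (D E : op_diagram P) (phi : nat_trans D E) :
  continuous (total_map phi).
Proof.
apply/continuousP => W [oW uW]; rewrite total_openE; split.
  move=> p; rewrite (_ : [set x | _] = phi p @^-1` [set y | W (tot y)]) //.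
  by apply: open_comp => // x _; exact: cts_fun.
move=> p q pq y /= h; apply: (uW _ _ pq).
by have := nt_natural phi pq y => /= <-.
Qed.

End TotalMap.

Section TotalMapLifting.
Context {R : realType} {d : Order.disp_t} {P : porderType d}.
Variables (D E : op_diagram P) (phi : nat_trans D E).

(* A lift into [D p] is composed with the section [tot] on the ball of
   radius 1/2, and continued by the values of [b] around it. *)
Lemma total_map_lifting (p : P) : ball_liftings (R := R) (phi p) setT ->
  ball_liftings (R := R) (total_map phi) (above p).
Proof.
move=> [inh L]; split.
  move=> [[q y] /= pq]; have [|x] := inh; last by constructor; exact: (tot x).
  by exists (diag_map E pq y).
move=> k a b ca cb aO fb.
pose B := unit_ball 'rV[R]_k; pose S := unit_sphere 'rV[R]_k.
have B0 : B 0 by rewrite /B /unit_ball /= normr0.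
(* [y0], and [x0] below, serve as default values of the projections outside [above p]. *)
have y0 : E p := diag_map E (aO 0 B0) (pt (a 0)).
have [|x0] := inh; first by exists y0.
have bO t : S t -> above p (b t).
  move=> tS; have := aO t (unit_sphere_ball tS); by rewrite -fb.
have projb t : S t -> phi p (total_proj x0 (b t)) = total_proj y0 (a t).
  move=> tS; have h := bO t tS; rewrite -fb // (total_projE _ h).
  rewrite (total_projE (F := E) (h := total_map phi (b t)) _ h).
  by have := nt_natural phi h (pt (b t)).
have [||//|t tS|x1 [G [cx1 x1b [cG G0 G1 _] GB]]] :=
    L k (total_proj y0 \o a) (total_proj x0 \o b).
- by apply: (within_comp (B := above p) (g := total_proj y0) _ ca aO);
  exact: total_proj_continuous.
- by apply: (within_comp (B := above p) (g := total_proj x0) _ cb bO);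
  exact: total_proj_continuous.
- exact: projb.
have c0 : 0 < 2^-1 :> R by lra.
have c1 : 2^-1 <= 1 :> R by lra.
pose c (t : 'rV[R]_k) := push 2^-1 t.
have cc : continuous c := continuous_push c0.
have cB t : B (c t) by exact: push_ball.
have cS t : 2^-1 <= `|t| -> S (c t) by exact: norm_push_ge.
have cId t : S t -> c t = t by exact: push_sphere.
pose M := [set t : 'rV[R]_k | `|t| <= 2^-1].
have clM : closed M by exact: closed_norm_le.
have nM t : ~ M t -> 2^-1 <= `|t| by rewrite /M /= => /negP; rewrite -ltNge =>
  /ltW.
pose b' t := if `[< M t >] then tot (x1 (c t)) else b (c t).
have cb' : {within B, continuous b'}.
  apply: total_glue => //.
  - apply: (within_comp (f := c) cx1); first exact: continuous_subspaceT.
    by move=> t _; exact: cB.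
  - apply: (within_comp (f := c) cb); first exact: continuous_subspaceT.
    by move=> t [_ /nM]; exact: cS.
  - move=> t _ /nM tM; exists (bO _ (cS _ tM)).
    by rewrite x1b /= ?(total_projE _ (bO _ (cS _ tM))) //; exact: cS.
(* Up to time 1/2 the ball stays squeezed by [c] while [G] runs; from then on the squeezing is
   undone linearly. *)
pose sg (s : R) : R := Num.max 0 (2 * s - 1).
pose g (x : R * 'rV[R]_k) : 'rV[R]_k :=
  (1 - sg x.1) *: c x.2 + sg x.1 *: x.2.
have cg : continuous g.
  by rewrite /g /sg; cont; apply: (cont_comp cc); cont.
have sg01 (s : R) : 0 <= s <= 1 -> 0 <= sg s <= 1.
  by move=> s01; rewrite /sg; case: (leP 0 (2 * s - 1)) => h; lra.
have gB (s : R) t : 0 <= s <= 1 -> B t -> B (g (s, t)).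
  move=> /sg01 /andP[s0 s1] t1; have := cB t; rewrite /g /=.
  move: (c t) => u; rewrite /B /unit_ball /= in t1 * => u1.
  apply: le_trans (ler_normD _ _) _; rewrite !normrZ !ger0_norm //; last by lra.
  have := normr_ge0 t; have := normr_ge0 u.
  by move: (sg s) s0 s1 `|t| `|u| t1 u1 => q *; nra.
have gl (s : R) t : s <= 2^-1 -> g (s, t) = c t.
  move=> s2; rewrite /g (_ : sg _ = 0); first by rewrite subr0 scale1r scale0r
    addr0.
  by rewrite /sg /= max_l //; lra.
have g1 t : g (1, t) = t.
  rewrite /g (_ : sg _ = 1); first by rewrite subrr scale0r scale1r add0r.
  by rewrite /sg /= max_r //; lra.
have gS s t : S t -> g (s, t) = t.
  by move=> tS; rewrite /g /= cId // -scalerDl subrK scale1r.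
(* The values are taken in [E p] only on this closed set. Outside it, [a (g x)] projects to [y x]:
   by definition after time 1/2, and before because [G] is stationary on the sphere. *)
pose N := [set x : R * 'rV[R]_k | x.1 <= 2^-1] `&` [set x | `|x.2| <= 2^-1].
have clN : closed N by apply: closedI; apply: closed_leP; cont.
pose y (x : R * 'rV[R]_k) :=
  if x.1 <= 2^-1 then G (2 * x.1, c x.2) else total_proj y0 (a (g x)).
pose H (x : R * 'rV[R]_k) := if `[< N x >] then tot (y x) else a (g x).
have cag : {within [set` `[0 : R, 1]] `*` B, continuous (a \o g)}.
  apply: (within_comp ca); first exact: continuous_subspaceT.
  by move=> [s t] [/= + tB]; rewrite in_itv /= => s01; exact: gB.
have cH : {within [set` `[0 : R, 1]] `*` B, continuous H}.
  apply: total_glue => //.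
  - apply: (within_paste_le (u := fun x : R * 'rV[R]_k => x.1) (c := 2^-1)
      (f := fun x => G (2 * x.1, c x.2)) (g := fun x =>
        total_proj y0 (a (g x)))).
    + by cont.
    + by move=> x _ h; rewrite /y h.
    + move=> [s t] [/= s01 tB] s2; rewrite /y /=; case: ifPn => // s2'.
      have -> : s = 2^-1 by apply/le_anti/andP.
      rewrite gl // (_ : 2 / 2 = 1) ?G1 //; [exact: cB|lra].
    + apply: (within_comp (f := fun x : R * 'rV[R]_k => (2 * x.1, c x.2)) cG).
        by apply: continuous_subspaceT; cont; apply: (cont_comp cc); cont.
      move=> [s t] [[/= + tB] /= s2]; rewrite in_itv /= => s01.
      by split; [rewrite /= in_itv /=; lra|exact: cB].
    + apply: (within_comp (B := above p) (f := a \o g) (g := total_proj y0)).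
        exact: total_proj_continuous.
        by apply: continuous_subspaceW cag => x [].
      move=> [s t] [[/= + tB] /= s2]; rewrite in_itv /= => s01.
      by apply: aO; exact: gB.
  - by apply: continuous_subspaceW cag => x [].
  - move=> [s t] [/= + tB] nN; rewrite in_itv /= => s01.
    have ag := aO _ (gB s t s01 tB); exists ag.
    rewrite -(total_projE y0) /y /=; case: ifPn => // s2.
    rewrite GB; [by rewrite /= gl|by lra|].
    by apply: cS; apply: nM => tM; apply: nN.
exists b', H; split => //.
- move=> t tS; rewrite /b'; case: asboolP => [|_]; last by rewrite cId.
  by rewrite /M /= tS => h; exfalso; lra.
- split => //.
  + move=> t tB; rewrite /H /b' /=; case: asboolP => [[_ h]|h].
      rewrite asboolT // /y /= ifT; last by lra.
      by rewrite mulr0 G0 //; exact: cB.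
    have tM : ~ M t by move=> tM; apply: h; split=> //=; lra.
    rewrite asboolF // gl; last by lra.
    by rewrite fb //; exact/cS/nM.
  + move=> t tB; rewrite /H; case: asboolP => [[/= h _]|_]; last by rewrite g1.
    by exfalso; lra.
  + move=> s t s01 tB; rewrite /H; case: asboolP => _; first exact: lexx.
    by apply: aO; exact: gB.
- move=> s t s01 tS; rewrite /H; case: asboolP => [[_ /=]|_];
  last by rewrite gS.
  by rewrite tS => h; exfalso; lra.
Qed.

End TotalMapLifting.

Section TotalEquivalence.
Context {R : realType} {d : Order.disp_t} {P : joinSemilatticeType d}.

Lemma ball_liftings_local (Z W : topologicalType) (f : Z -> W) (I : Type)
    (O : I -> set W) :
  (forall i, open (O i)) -> (forall w, exists i, O i w) ->
  (forall i j, exists l, O i `&` O j = O l) ->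
  (forall i, ball_liftings (R := R) f (O i)) -> ball_liftings (R := R) f setT.
Proof.
move=> oO cO OI LO; split.
  by move=> [w _]; have [i Oi] := cO w; apply: (LO i).1; exists w.
apply: (rel_lifting_local (Os := range O)).
- by move=> _ [i _ <-].
- by move=> w; have [i Oi] := cO w; exists (O i) => //; exists i.
- by move=> _ _ [i _ <-] [j _ <-]; have [l ->] := OI i j; exists l.
- by move=> _ [i _ <-]; exact: (LO i).2.
Qed.

(** Joins make the sets [above p] closed under intersection, and over each of them the lifting
    problem reduces to [phi p]. *)
Theorem total_map_equivalence (D E : op_diagram P) (phi : nat_trans D E) :
  (forall p, ball_liftings (R := R) (phi p) setT) ->
  weak_homotopy_equivalence R (total_map phi).
Proof.
move=> L; apply: ball_liftings_equivalence; first exact: total_map_continuous.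
apply: (ball_liftings_local (O := fun p : P => above p)).
- by move=> p; exact: above_open.
- by move=> h; exists (idx h); exact: lexx.
- move=> p q; exists (Order.join p q).
  by apply/seteqP; split => h /=; rewrite /above /= leUx => /andP.
- by move=> p; exact: total_map_lifting.
Qed.

(** * Comparison of the model with a space covered by the members of the diagram *)

Section Augmentation.
Variables (F : op_diagram P) (W : topologicalType) (i : forall p, F p -> W).
Hypothesis ci : forall p, continuous (@i p).
Hypothesis inj_i : forall p, injective (@i p).
Hypothesis open_i : forall p (V : set (F p)), open V -> open (@i p @` V).
Hypothesis i_map : forall p q (pq : (p <= q)%O) (y : F q),
  i (diag_map F pq y) = i y.
Hypothesis i_cover : forall w, exists p, range (@i p) w.
Hypothesis i_join : forall p q,
  range (@i p) `&` range (@i q) `<=` range (@i (Order.join p q)).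

Definition augmentation (h : total F) : W := i (pt h).

Lemma augmentation_continuous : continuous augmentation.
Proof.
apply/continuousP => V oV; rewrite total_openE; split => [p|p q pq y].
  rewrite (_ : [set x | _] = @i p @^-1` V) //.
  by apply: open_comp => // x _; exact: ci.
by rewrite /= /augmentation /= i_map.
Qed.

Lemma range_le p q : (p <= q)%O -> range (@i q) `<=` range (@i p).
Proof. by move=> pq _ [y _ <-]; exists (diag_map F pq y). Qed.

(** A converse to [idx_near]: since each [i p] is open and injective, the image in [W] determines
    the point once its index is known, so continuity in [W] and locally rising indices suffice. *)
Lemma augmentation_within (T : topologicalType) (A : set T) (K : T -> total F) :
  {within A, continuous (augmentation \o K)} ->
  (forall t, A t -> \forall t' \near t, A t' -> (idx (K t) <= idx (K t'))%O) ->
  {within A, continuous K}.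
Proof.
move=> /within_continuousP cK iK; apply/total_within_continuousP =>
  t At V oV Vt.
have := cK t At (@i _ @` V).
move=> /(_ (open_nbhs_nbhs (conj (open_i oV) _))) h.
apply: filterS2 (iK t At) (h _); last by exists (pt (K t)).
move=> t' pq + At' => /(_ At') [v Vv ve]; exists (pq At').
suff -> : diag_map F (pq At') (pt (K t')) = v by [].
by apply: inj_i; rewrite i_map ve.
Qed.

(* A lift with values in [F q] on the ball of radius 1/2 and the given values
   on the sphere are joined through values in [F (p `|` q)], of which both
   are specializations. *)
Lemma augmentation_lifting q :
  ball_liftings (R := R) augmentation (range (@i q)).
Proof.
split; first by move=> [_ [x _ _]]; constructor; exact: (tot x).
move=> k a b ca cb aO ab.
pose S := unit_sphere 'rV[R]_k; pose B := unit_ball 'rV[R]_k.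
(* The point of [F p] over [w], unique by injectivity; [b 0] is the default when [w] is not in the
   image of [F p]. *)
pose lift p w : total F := xget (b 0) [set h | idx h = p /\ augmentation h = w].
have liftP p w : range (@i p) w ->
    idx (lift p w) = p /\ augmentation (lift p w) = w.
  move=> [x _ xw].
  have h : exists h, [set h | idx h = p /\ augmentation h = w] h.
    by exists (tot x).
  exact: (xgetPex (b 0) h).
have c0 : 0 < 2^-1 :> R by lra.
have c1 : 2^-1 <= 1 :> R by lra.
pose c (t : 'rV[R]_k) := push 2^-1 t.
have cc : continuous c := continuous_push c0.
have cB t : B (c t) by exact: push_ball.
have cS t : 2^-1 <= `|t| -> S (c t) by exact: norm_push_ge.
have cId t : S t -> c t = t by exact: push_sphere.
pose al t := idx (b (c t)).
(* The closed zones carry the indices [al t] and [q], the open ring between them the join; together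
   with the local rise of [al] this makes the index rise near every point. In [W] all three zones
   give [a (c t)]. *)
pose b' t := if 1 <= `|t| then b (c t) else
  if `|t| <= 2^-1 then lift q (a (c t)) else lift (Order.join (al t) q) (a (c
    t)).
have join_range t : 2^-1 <= `|t| -> range (@i (Order.join (al t) q)) (a (c t)).
  move=> t2; apply: i_join; split; last by apply: aO; exact: cB.
  by rewrite -ab; [exists (pt (b (c t)))|exact: cS].
have b'a t : augmentation (b' t) = a (c t).
  rewrite /b'; case: ifPn => [t1|t1].
    by rewrite ab //; apply: cS; lra.
  case: ifPn => t2; first by have [] := liftP q (a (c t)) (aO _ (cB t)).
  by have [|//] := liftP _ _ (join_range t _); rewrite -ltNge in t2; exact: ltW.
have b'i t : idx (b' t) = if 1 <= `|t| then al t else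
    if `|t| <= 2^-1 then q else Order.join (al t) q.
  rewrite /b'; case: ifPn => [//|t1].
  case: ifPn => t2; first by have [] := liftP q (a (c t)) (aO _ (cB t)).
  by have [|//] := liftP _ _ (join_range t _); rewrite -ltNge in t2; exact: ltW.
have cbc : {within [set t | 2^-1 <= `|t|], continuous (b \o c)}.
  apply: (within_comp cb); first exact: continuous_subspaceT.
  by move=> t; exact: cS.
have near_gt (r : R) (t : 'rV[R]_k) : r < `|t| -> \forall t' \near t, r < `|t'|.
  move=> rt; have : nbhs t (~` [set x | `|x| <= r]).
    apply: open_nbhs_nbhs; split; last by move=> /=; rewrite leNgt rt.
    by apply: closed_openC; exact: closed_norm_le.
  by apply: filterS => x /= /negP; rewrite -ltNge.
have near_lt (r : R) (t : 'rV[R]_k) : `|t| < r -> \forall t' \near t, `|t'| < r.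
  move=> rt; have : nbhs t (~` [set x | r <= `|x|]).
    apply: open_nbhs_nbhs; split; last by move=> /=; rewrite leNgt rt.
    by apply: closed_openC; exact: closed_norm_ge.
  by apply: filterS => x /= /negP; rewrite -ltNge.
have al_near t : 2^-1 < `|t| -> \forall t' \near t, (al t <= al t')%O.
  move=> t2; apply: filterS2 (near_gt _ _ t2) (idx_near cbc (ltW t2)).
  by move=> t' h; apply; exact: ltW.
have cac : {within B, continuous (a \o c)}.
  by apply: (within_comp ca); [exact: continuous_subspaceT|move=> t _;
    exact: cB].
have cb' : {within B, continuous b'}.
  apply: augmentation_within; first by apply: within_eq cac => t _ /=;
    rewrite b'a.
  move=> t tB; rewrite b'i; case: ifPn => [t1|]; last rewrite -ltNge => t1.
    have t2 : 2^-1 < `|t| by lra.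
    apply: filterS2 (near_gt _ _ t2) (al_near _ t2) => t' t'2 h _.
    rewrite b'i; case: ifPn => // _; rewrite leNgt t'2 /=.
    exact: le_trans h (leUl _ _).
  case: ifPn => [t2|]; last rewrite -ltNge => t2.
    apply: filterS (near_lt _ _ t1) => t' h _.
    rewrite b'i leNgt h /=; case: ifPn => // _; exact: leUr.
  apply: filterS2 (near_lt _ _ t1) (filterI (near_gt _ _ t2) (al_near _ t2)).
  move=> t' h1 [h2 h3] _; rewrite b'i leNgt h1 /= leNgt h2 /=.
  by rewrite leUx leUr andbT; exact: le_trans h3 (leUl _ _).
pose g (x : R * 'rV[R]_k) : 'rV[R]_k := (1 - x.1) *: c x.2 + x.1 *: x.2.
have cg : continuous g by rewrite /g; cont; apply: (cont_comp cc); cont.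
have gB (s : R) t : 0 <= s <= 1 -> B t -> B (g (s, t)).
  move=> /andP[s0 s1] t1; have := cB t; rewrite /g /=.
  move: (c t) => u; rewrite /B /unit_ball /= in t1 * => u1.
  apply: le_trans (ler_normD _ _) _; rewrite !normrZ !ger0_norm //; last by lra.
  have := normr_ge0 t; have := normr_ge0 u.
  by move: `|t| `|u| t1 u1 => *; nra.
exists b', (a \o g); split=> //.
- by move=> t tS; rewrite /b' tS lexx cId.
- split=> //=.
  + apply: (within_comp ca); first exact: continuous_subspaceT.
    by move=> [s t] [/= + tB]; rewrite in_itv /= => s01; exact: gB.
  + by move=> t tB; rewrite b'a /g /= subr0 scale1r scale0r addr0.
  + by move=> t tB; rewrite /g /= subrr scale1r scale0r add0r.
  + by move=> s t s01 tB; apply: aO; exact: gB.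
- by move=> s t s01 tS; rewrite /= /g /= cId // -scalerDl subrK scale1r.
Qed.

Theorem augmentation_equivalence : weak_homotopy_equivalence R augmentation.
Proof.
apply: ball_liftings_equivalence; first exact: augmentation_continuous.
apply: (ball_liftings_local (O := fun p => range (@i p))).
- by move=> p; exact/open_i/openT.
- exact: i_cover.
- move=> p q; exists (Order.join p q); apply/seteqP; split; first exact: i_join.
  by move=> w wpq; split; apply: range_le wpq; [exact: leUl|exact: leUr].
- exact: augmentation_lifting.
Qed.

End Augmentation.

End TotalEquivalence.

(** * Configuration spaces of products *)

Section BallLiftings.
Context {R : realType}.

Lemma id_ball_liftings (Z : topologicalType) :
  ball_liftings (R := R) (fun x : Z => x) setT.
Proof.
split; first by move=> [z _]; constructor.
move=> k a b ca cb _ ab; exists a, (a \o snd); split=> //.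
  by move=> t tS; rewrite ab.
split=> //; apply: (within_comp (f := snd) ca); last by move=> x [].
by apply: continuous_subspaceT; cont.
Qed.

Lemma prod_ball_liftings (Z W Z' W' : topologicalType) (f : Z -> W)
    (f' : Z' -> W') :
  ball_liftings (R := R) f setT -> ball_liftings (R := R) f' setT ->
  ball_liftings (R := R) (fun x : Z * Z' => (f x.1, f' x.2)) setT.
Proof.
move=> [inh L] [inh' L']; split.
  move=> [[w w'] _]; have [|z] := inh; first by exists w.
  by have [|z'] := inh'; [exists w'|constructor].
move=> k a b ca cb _ fb.
have fst_within (T S U : topologicalType) (A : set T) (g : T -> S * U) :
    {within A, continuous g} -> {within A, continuous (fun x => (g x).1)}.
  by move=> cg; apply: (within_compl (g := fst) _ cg); cont.
have snd_within (T S U : topologicalType) (A : set T) (g : T -> S * U) :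
    {within A, continuous g} -> {within A, continuous (fun x => (g x).2)}.
  by move=> cg; apply: (within_compl (g := snd) _ cg); cont.
have [//|t tS|c [H [cc cb1 [cH H0 H1 _] HS]]] :=
  L k _ _ (fst_within _ _ _ _ _ ca) (fst_within _ _ _ _ _ cb).
  by rewrite -fb.
have [//|t tS|c' [H' [cc' cb1' [cH' H0' H1' _] HS']]] :=
  L' k _ _ (snd_within _ _ _ _ _ ca) (snd_within _ _ _ _ _ cb).
  by rewrite -fb.
exists (fun t => (c t, c' t)), (fun x => (H x, H' x)); split.
- exact: within_pair.
- by move=> t tS; rewrite cb1 // cb1' // -surjective_pairing.
- split=> //.
  + exact: within_pair.
  + by move=> t tB; rewrite H0 // H0'.
  + by move=> t tB; rewrite H1 // H1' // -surjective_pairing.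
- by move=> s t s01 tS; rewrite HS // HS' // -surjective_pairing.
Qed.

End BallLiftings.

Section UnionGraph.
Context {n : nat}.
Implicit Types G H K : sgraph n.

Lemma union_graph_subproof G H :
  [forall e in (edges G :|: edges H)%SET, #|e| == 2].
Proof.
apply/forall_inP => e; rewrite finset.in_setU.
by case/orP => [/(forall_inP (edges_card2 G))|/(forall_inP (edges_card2 H))].
Qed.

Definition union_graph G H : sgraph n := SGraph (union_graph_subproof G H).

Lemma adjacent_union G H i j :
  adjacent (union_graph G H) i j = adjacent G i j || adjacent H i j.
Proof. by rewrite /adjacent finset.in_setU. Qed.

Lemma union_graph_le G H K :
  (union_graph G H <= K)%O = (G <= K)%O && (H <= K)%O.
Proof. by rewrite !le_sgraphE finset.subUset. Qed.

Lemma distinct_graph_subproof (T : Type) (z : 'I_n -> T) :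
  [forall e in [set e : {set 'I_n} |
    `[< exists i j, e = [set i; j]%SET /\ z i <> z j >]]%SET, #|e| == 2].
Proof.
apply/forall_inP => e; rewrite finset.inE => /asboolP [i [j [-> zij]]].
by rewrite cards2; have [ij|//] := eqVneq i j; case: zij; rewrite ij.
Qed.

(** The largest graph [G] such that [z] is a configuration for [G]. *)
Definition distinct_graph (T : Type) (z : 'I_n -> T) : sgraph n :=
  SGraph (distinct_graph_subproof z).

Lemma adjacent_distinct (T : Type) (z : 'I_n -> T) i j :
  adjacent (distinct_graph z) i j <-> z i <> z j.
Proof.
rewrite /adjacent finset.inE; split=> [/asboolP [k [l [e zkl]]]|zij];
  last first.
  by apply/asboolP; exists i, j.
have := finset.set21 k l; have := finset.set22 k l; rewrite -e !finset.in_set2.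
move=> /orP[] /eqP lE /orP[] /eqP kE; subst k l => //.
by move=> /esym.
Qed.

End UnionGraph.

(** * The join semilattice of pairs of graphs with complete union *)

Section CoveringPairs.
Variable n : nat.

Definition covers (p : sgraph n * sgraph n) : bool :=
  [forall i, forall j, (i != j) ==> adjacent p.1 i j || adjacent p.2 i j].

Record cover_pair :=
  CoverPair { graphs : sgraph n * sgraph n; graphs_covers : covers graphs }.

HB.instance Definition _ := [isSub for graphs].
HB.instance Definition _ := [Choice of cover_pair by <:].

Implicit Types p q r : cover_pair.

Definition le_pair p q : bool :=
  ((graphs p).1 <= (graphs q).1)%O && ((graphs p).2 <= (graphs q).2)%O.

Lemma le_pair_refl : reflexive le_pair.
Proof. by move=> p; rewrite /le_pair !lexx. Qed.

Lemma le_pair_anti : antisymmetric le_pair.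
Proof.
move=> p q /andP[/andP[pq1 pq2] /andP[qp1 qp2]]; apply: val_inj => /=.
rewrite [LHS]surjective_pairing [RHS]surjective_pairing.
by congr pair; apply: le_anti; apply/andP.
Qed.

Lemma le_pair_trans : transitive le_pair.
Proof.
move=> q p r /andP[pq1 pq2] /andP[qr1 qr2].
by rewrite /le_pair (le_trans pq1) // (le_trans pq2).
Qed.

HB.instance Definition _ := Order.Le_isPOrder.Build
  Order.SetSubsetOrder.subset_display cover_pair
  le_pair_refl le_pair_anti le_pair_trans.

Lemma coversP p i j : i != j ->
  adjacent (graphs p).1 i j || adjacent (graphs p).2 i j.
Proof. by move=> ij; have /forallP/(_ i)/forallP/(_ j)/implyP :=
  graphs_covers p; exact. Qed.

Lemma join_pair_subproof p q :
  covers (union_graph (graphs p).1 (graphs q).1,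
          union_graph (graphs p).2 (graphs q).2).
Proof.
apply/forallP => i; apply/forallP => j; apply/implyP => ij /=.
rewrite !adjacent_union; have /orP[->|->] := coversP p ij; first by [].
by rewrite /= orbT.
Qed.

Definition join_pair p q : cover_pair := CoverPair (join_pair_subproof p q).

Lemma join_pair_le p q r : (join_pair p q <= r)%O = (p <= r)%O && (q <= r)%O.
Proof.
rewrite /Order.le /= /le_pair /= !union_graph_le; exact: andbACA.
Qed.

HB.instance Definition _ := Order.POrder_isJoinSemilattice.Build
  Order.SetSubsetOrder.subset_display cover_pair join_pair_le.

Lemma le_pair1 p q : (p <= q)%O -> ((graphs p).1 <= (graphs q).1)%O.
Proof. by case/andP. Qed.

Lemma le_pair2 p q : (p <= q)%O -> ((graphs p).2 <= (graphs q).2)%O.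
Proof. by case/andP. Qed.

End CoveringPairs.

Section ProductDiagram.
Context {n : nat}.
Implicit Types D E : op_diagram (sgraph n).

Lemma prod_map_continuous (Z W Z' W' : topologicalType) (f : Z -> W)
    (f' : Z' -> W') : continuous f -> continuous f' ->
  continuous (fun x : Z * Z' => (f x.1, f' x.2)).
Proof.
by move=> cf cf'; cont; [apply: (cont_comp cf)|apply: (cont_comp cf')]; cont.
Qed.

Definition prod_cts (Z W Z' W' : topologicalType) (f : continuousType Z W)
    (f' : continuousType Z' W') :
    continuousType (Z * Z')%type (W * W')%type :=
  mkcts (prod_map_continuous (@cts_fun _ _ f) (@cts_fun _ _ f')).

Section Diagram.
Variables D E : op_diagram (sgraph n).

Definition pair_obj (p : cover_pair n) : topologicalType :=
  (D (graphs p).1 * E (graphs p).2)%type.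

Definition pair_map (p q : cover_pair n) (pq : (p <= q)%O) :
    continuousType (pair_obj q) (pair_obj p) :=
  prod_cts (diag_map D (le_pair1 pq)) (diag_map E (le_pair2 pq)).

Lemma pair_map_id p (pp : (p <= p)%O) : pair_map pp =1 id.
Proof.
move=> [x y].
by change ((diag_map D (le_pair1 pp) x, diag_map E (le_pair2 pp) y) = (x, y));
  rewrite !diag_map_id.
Qed.

Lemma pair_map_comp p q r (pq : (p <= q)%O) (qr : (q <= r)%O) (pr : (p <= r)%O)
  :
  pair_map pq \o pair_map qr =1 pair_map pr.
Proof.
move=> [x y]; apply/pair_equal_spec; split.
  exact: (diag_map_comp (le_pair1 pq) (le_pair1 qr) (le_pair1 pr) x).
exact: (diag_map_comp (le_pair2 pq) (le_pair2 qr) (le_pair2 pr) y).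
Qed.

Definition pair_diagram : op_diagram (cover_pair n) :=
  OpDiagram pair_map_id pair_map_comp.

End Diagram.

Section NatTrans.
Variables (D E D' E' : op_diagram (sgraph n)).
Variables (phi : nat_trans D D') (psi : nat_trans E E').

Lemma pair_natural (p q : cover_pair n) (pq : (p <= q)%O) :
  prod_cts (phi (graphs p).1) (psi (graphs p).2) \o diag_map (pair_diagram D E)
    pq
  =1 diag_map (pair_diagram D' E') pq \o
     prod_cts (phi (graphs q).1) (psi (graphs q).2).
Proof.
move=> [x y]; apply/pair_equal_spec; split.
  exact: (nt_natural phi (le_pair1 pq) x).
exact: (nt_natural psi (le_pair2 pq) y).
Qed.

Definition pair_nat_trans : nat_trans (pair_diagram D E) (pair_diagram D' E') :=
  @NatTrans _ _ (pair_diagram D E) (pair_diagram D' E')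
    (fun p => prod_cts (phi (graphs p).1) (psi (graphs p).2)) pair_natural.

End NatTrans.

Lemma id_natural D a b (ab : (a <= b)%O) :
  (mkcts (@cont_id (D a)) : continuousType (D a) (D a)) \o diag_map D ab
  =1 diag_map D ab \o (mkcts (@cont_id (D b)) : continuousType (D b) (D b)).
Proof. by []. Qed.

Definition id_nat_trans D : nat_trans D D :=
  @NatTrans _ _ D D (fun a => mkcts (@cont_id (D a))) (@id_natural D).

End ProductDiagram.

Section DiagramInvariance.
Context {R : realType} {n : nat}.
Implicit Types D E : op_diagram (sgraph n).

Lemma total_pair_equivalence D E D' E' (phi : nat_trans D D')
    (psi : nat_trans E E') :
  (forall G, ball_liftings (R := R) (phi G) setT) ->
  (forall G, ball_liftings (R := R) (psi G) setT) ->
  weakly_equivalent R (total (pair_diagram D E)) (total (pair_diagram D' E')).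
Proof.
move=> Lphi Lpsi; apply: rst_step; exists (total_map (pair_nat_trans phi psi)).
by apply: total_map_equivalence => p; exact: prod_ball_liftings.
Qed.

(** The zigzag is followed with [E] fixed: each of its steps is paired with the identity of [E], and
    may point in either direction. *)
Lemma total_pair_left D D' E : diagrams_weakly_equivalent R D D' ->
  weakly_equivalent R (total (pair_diagram D E)) (total (pair_diagram D' E)).
Proof.
elim=> {D D'} [D D' [phi wphi]|D|D D' _|D D' D'' _ h1 _ h2].
- apply: (total_pair_equivalence (phi := phi) (psi := id_nat_trans E)) => G.
    exact: equivalence_ball_liftings.
  exact: id_ball_liftings.
- exact: rst_refl.
- exact: rst_sym.
- exact: rst_trans h1 h2.
Qed.

Lemma total_pair_right D E E' : diagrams_weakly_equivalent R E E' ->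
  weakly_equivalent R (total (pair_diagram D E)) (total (pair_diagram D E')).
Proof.
elim=> {E E'} [E E' [psi wpsi]|E|E E' _|E E' E'' _ h1 _ h2].
- apply: (total_pair_equivalence (phi := id_nat_trans D) (psi := psi)) => G.
    exact: id_ball_liftings.
  exact: equivalence_ball_liftings.
- exact: rst_refl.
- exact: rst_sym.
- exact: rst_trans h1 h2.
Qed.

End DiagramInvariance.

(** * The cover of the configuration space of a product *)

Section Configurations.
Context {n : nat}.

Lemma ptws_coord_continuous (Z : topologicalType) (i : 'I_n) :
  continuous (fun z : {ptws 'I_n -> Z} => z i).
Proof. exact: (@proj_continuous _ (fun=> Z) i). Qed.

Lemma ptws_continuous (T Z : topologicalType) (g : T -> {ptws 'I_n -> Z}) :
  (forall i, continuous (fun t => g t i)) -> continuous g.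
Proof.
move=> cg t; apply/cvg_sup => i.
exact: (@continuous_comp_initial _ _ _ (fun z : 'I_n -> Z => z i) g (cg i)).
Qed.

(** Disjoint neighbourhoods of [z i] and [z j] keep these two coordinates distinct, and there are
    finitely many pairs. *)
Lemma conf_set_open (G : sgraph n) (Z : topologicalType) :
  hausdorff_space Z -> open (conf_set G Z).
Proof.
rewrite open_hausdorff => hZ; rewrite openE => z zG.
pose T : topologicalType := {ptws 'I_n -> Z}.
have near_ij i j : nbhs (z : T) [set z' : T | adjacent G i j -> z' i <> z' j].
  have [Gij|Gij] := boolP (adjacent G i j); last first.
    by apply: (@filterS T _ _ setT) => //; exact: filterT.
  have /eqP/hZ [[U V] /= [/set_mem Ui /set_mem Vj] [oU oV UV]] := zG i j Gij.
  have hi := ptws_coord_continuous (open_nbhs_nbhs (conj oU Ui)).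
  have hj := ptws_coord_continuous (open_nbhs_nbhs (conj oV Vj)).
  apply: (@filterS2 T _ _ _ _ _ _ hi hj) => z' Ui' Vj' _ e.
  have : (U `&` V) (z' i) by split => //; rewrite e.
  by rewrite (eqP UV).
have near_i i : nbhs (z : T) [set z' : T | forall j, adjacent G i j ->
  z' i <> z' j].
  exact: (@filter_forall T _ _ _ _ (near_ij i)).
exact: (@filter_forall T _ _ _ _ near_i).
Qed.

Section Coordinates.
Variables (X Y : topologicalType).
Hypotheses (hX : hausdorff_space X) (hY : hausdorff_space Y).

Local Notation W := (Conf (complete_graph n) (X * Y)%type).

Definition conf_fst (w : W) : {ptws 'I_n -> X} := fun i => (val w i).1.
Definition conf_snd (w : W) : {ptws 'I_n -> Y} := fun i => (val w i).2.

Lemma conf_val_continuous (G : sgraph n) (Z : topologicalType) :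
  continuous (fun z : Conf G Z => val z : {ptws 'I_n -> Z}).
Proof. exact: initial_continuous. Qed.

Lemma conf_fst_continuous : continuous conf_fst.
Proof.
apply: ptws_continuous => i; apply: cont_fst.
apply: (cont_comp (@ptws_coord_continuous _ i)).
exact: conf_val_continuous.
Qed.

Lemma conf_snd_continuous : continuous conf_snd.
Proof.
apply: ptws_continuous => i; apply: cont_snd.
apply: (cont_comp (@ptws_coord_continuous _ i)).
exact: conf_val_continuous.
Qed.

Local Notation F := (pair_diagram (conf_diagram n X) (conf_diagram n Y)).

Definition conf_pair_fun (p : cover_pair n) (x : F p) :
  {ptws 'I_n -> (X * Y)%type} := fun i => (val x.1 i, val x.2 i).

Lemma conf_pair_subproof (p : cover_pair n) (x : F p) :
  conf_pair_fun x \in conf_set (complete_graph n) (X * Y)%type.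
Proof.
apply/mem_set => i j; rewrite adjacent_complete => ij [e1 e2].
have h1 : conf_set (graphs p).1 X (val x.1) by exact: set_mem (valP x.1).
have h2 : conf_set (graphs p).2 Y (val x.2) by exact: set_mem (valP x.2).
by have /orP[/h1|/h2] := coversP p ij.
Qed.

Definition conf_pair (p : cover_pair n) (x : F p) : W :=
  exist _ (conf_pair_fun x) (conf_pair_subproof x).

Lemma conf_pair_continuous p : continuous (@conf_pair p).
Proof.
apply: continuous_comp_initial; apply: ptws_continuous => i.
apply: cont_pair.
  apply: (cont_comp (f := fun x : F p => val x.1 : {ptws 'I_n -> X})
    (@ptws_coord_continuous X i)).
  apply: (cont_comp (f := fun x : F p => x.1) (@conf_val_continuous _ X)).
  by move=> x; exact: cvg_fst.
apply: (cont_comp (f := fun x : F p => val x.2 : {ptws 'I_n -> Y})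
  (@ptws_coord_continuous Y i)).
apply: (cont_comp (f := fun x : F p => x.2) (@conf_val_continuous _ Y)).
by move=> x; exact: cvg_snd.
Qed.

Lemma conf_pair_inj p : injective (@conf_pair p).
Proof.
move=> [x y] [x' y'] /(congr1 val) /= e.
have ei i : (val x i, val y i) = (val x' i,
  val y' i) by exact: (congr1 (@^~ i) e).
congr pair; apply: val_inj; apply/funext => i; by case: (ei i).
Qed.

Lemma conf_pairP p (w : W) : range (@conf_pair p) w <->
  conf_set (graphs p).1 X (conf_fst w) /\ conf_set (graphs p).2 Y (conf_snd w).
Proof.
split=> [[[x y] _ <-]|[h1 h2]].
  by split; [exact: set_mem (valP x)|exact: set_mem (valP y)].
exists (exist _ (conf_fst w) (mem_set h1),
  exist _ (conf_snd w) (mem_set h2)) => //.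
by apply: val_inj; apply/funext => i; exact/esym/surjective_pairing.
Qed.

(** An open set of [Conf G X] is the trace of an open set of the power of [X]; as the configurations
    for [G] are themselves open there, membership in the image is an open condition on both
    projections of [w]. *)
Lemma conf_pair_open p (V : set (F p)) : open V -> open (@conf_pair p @` V).
Proof.
move=> oV; rewrite openE => _ [[x y] Vxy <-].
have [[A B] /= [+ +] ABV] := open_nbhs_nbhs (conj oV Vxy).
rewrite !nbhsE => -[_ [[A' oA' <-] A'x] A'A] [_ [[B' oB' <-] B'y] B'B].
set w := conf_pair _.
have w1 : conf_fst w = val x by [].
have w2 : conf_snd w = val y by [].
have hG1 : nbhs w (conf_fst @^-1` (A' `&` conf_set (graphs p).1 X)).
  apply: conf_fst_continuous; rewrite w1; apply: open_nbhs_nbhs; split.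
    by apply: openI => //; exact: conf_set_open.
  by split=> //; exact: set_mem (valP x).
have hG2 : nbhs w (conf_snd @^-1` (B' `&` conf_set (graphs p).2 Y)).
  apply: conf_snd_continuous; rewrite w2; apply: open_nbhs_nbhs; split.
    by apply: openI => //; exact: conf_set_open.
  by split=> //; exact: set_mem (valP y).
apply: filterS2 hG1 hG2 => w' [A'w h1] [B'w h2].
exists (exist _ (conf_fst w') (mem_set h1), exist _ (conf_snd w') (mem_set h2)).
  by apply: ABV; split; [exact: A'A|exact: B'B].
by apply: val_inj; apply/funext => i; exact/esym/surjective_pairing.
Qed.

Lemma conf_pair_map p q (pq : (p <= q)%O) (x : F q) :
  conf_pair (diag_map F pq x) = conf_pair x.
Proof. exact: val_inj. Qed.

Lemma conf_pair_cover (w : W) : exists p, range (@conf_pair p) w.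
Proof.
(* Distinct points of a product differ in one of the two coordinates. *)
have cov : covers (distinct_graph (conf_fst w), distinct_graph (conf_snd w)).
  apply/forallP => i; apply/forallP => j; apply/implyP => ij /=.
  have wij : val w i <> val w j.
    by apply: (set_mem (valP w)); rewrite adjacent_complete.
  have [e1|e1] := pselect (conf_fst w i = conf_fst w j); last first.
    by apply/orP; left; apply/adjacent_distinct.
  apply/orP; right; apply/adjacent_distinct => e2; apply: wij.
  rewrite [LHS]surjective_pairing [RHS]surjective_pairing; exact: congr2 e1 e2.
exists (CoverPair cov); apply/conf_pairP.
by split=> i j /adjacent_distinct.
Qed.

Lemma conf_pair_join p q : range (@conf_pair p) `&` range (@conf_pair q) `<=`
  range (@conf_pair (Order.join p q)).
Proof.
move=> w [/conf_pairP [p1 p2] /conf_pairP [q1 q2]]; apply/conf_pairP.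
split=> i j /=; rewrite adjacent_union => /orP[];
  [exact: p1|exact: q1|exact: p2|exact: q2].
Qed.

Lemma conf_product_equivalence (R : realType) :
  weakly_equivalent R (total F) W.
Proof.
apply: rst_step; exists (augmentation conf_pair).
apply: augmentation_equivalence.
- exact: conf_pair_continuous.
- exact: conf_pair_inj.
- exact: conf_pair_open.
- exact: conf_pair_map.
- exact: conf_pair_cover.
- exact: conf_pair_join.
Qed.

End Coordinates.

End Configurations.

Theorem corollary1p9 (R : realType) (n : nat)
    (X X' Y Y' : topologicalType) :
  hausdorff_space X -> hausdorff_space X' ->
  hausdorff_space Y -> hausdorff_space Y' ->
  diagrams_weakly_equivalent R (conf_diagram n X) (conf_diagram n X') ->
  diagrams_weakly_equivalent R (conf_diagram n Y) (conf_diagram n Y') ->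
  weakly_equivalent R
    (Conf (complete_graph n) (X * Y)%type)
    (Conf (complete_graph n) (X' * Y')%type).
Proof.
move=> hX hX' hY hY' wX wY.
(* The chain is assembled from its far end: the first space is replaced while [Y] is fixed, then the
   second while [X'] is fixed, between the two comparisons with configuration spaces of products. *)
apply: rst_trans (conf_product_equivalence hX' hY' R).
apply: rst_trans (total_pair_right _ wY).
apply: rst_trans (total_pair_left _ wX).
exact/rst_sym/conf_product_equivalence.
Qed.
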